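(* Suppose that $f$ is twice continuously differentiable with $\nabla f$ Lipschitz continuous with constant $L$, and that $h$ is convex (possibly nonsmooth) and Lipschitz continuous with constant $L_h$. Let $\{X_k\}$ be generated by the ManPQN algorithm described in the context, where for all $k$ the operator $\mathcal{B}_k$ satisfies $\kappa_1\|V\|^2\le\|V\|_{\mathcal{B}_k}^2\le\kappa_2\|V\|^2$ for all $V\in {\rm T}_{X_k}\mathcal{M}$. Suppose $\{X_k\}$ has an accumulation point $X^*$ such that $$\lambda_{\min}\big({\rm Hess}(f\circ\mathbf{R}_{X^*})(0_{X^*})\big)\ge\widetilde{\eta}\quad\text{for some }\widetilde{\eta}>5L_hM_2.$$ Then there exist an integer $K$, $\mu>0$ and $\tau\in(0,1)$ such that $$F(X_k)-F(X^* )\le\mu\,\tau^{k-K}\big(F(X_{l(K)})-F(X^* )\big)\quad\text{for all }k>K.$$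
   Context: Let $\mathcal{M}={\rm St}(n,r)=\{X\in\mathbb{R}^{n\times r}: X^\top X=I_r\}$ with the Riemannian metric $\langle\xi,\zeta\rangle={\rm tr}(\xi^\top\zeta)$ and $\|\cdot\|$ the induced (Frobenius) norm. Its tangent space is ${\rm T}_X\mathcal{M}=\{V\in\mathbb{R}^{n\times r}: V^\top X+X^\top V=0\}$, with zero element $0_X$. Let $f,h:\mathbb{R}^{n\times r}\to\mathbb{R}$ and $F=f+h$; $\nabla f$ is the Euclidean gradient. Let $\mathbf{R}$ be a retraction on $\mathcal{M}$: a smooth map from the tangent bundle to $\mathcal{M}$ whose restriction $\mathbf{R}_X$ to ${\rm T}_X\mathcal{M}$ satisfies $\mathbf{R}_X(0_X)=X$ and ${\rm D}\mathbf{R}_X(0_X)={\bf id}$. ${\rm Hess}(f\circ\mathbf{R}_X)$ is the Hessian of the function $f\circ\mathbf{R}_X$ on the Euclidean space ${\rm T}_X\mathcal{M}$, and $\lambda_{\min}$ its smallest eigenvalue. Since $\mathcal{M}$ is compact, there are (known result) constants $M_1,M_2>0$, fixed once and for all, with $\|\mathbf{R}_X(\xi)-X\|\le M_1\|\xi\|$ and $\|\mathbf{R}_X(\xi)-X-\xi\|\le M_2\|\xi\|^2$ for all $X\in\mathcal{M}$, $\xi\in{\rm T}_X\mathcal{M}$. Constants: $\varrho=\sup_{X\in\mathcal{M}}\|\nabla f(X)\|$; for parameters $\delta>0$ and a positive integer $p$, with $\upsilon=(4L+4\varrho+5\delta)/\delta$, $$\kappa_1=\Big(\frac{\upsilon^{2p}-1}{\upsilon^2-1}\cdot\frac4\delta+\frac{\upsilon^{2p}}{\delta}\Big)^{-1},\qquad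 \kappa_2=\delta+\frac{4(L+\varrho+\delta)^2}{\delta}p.$$ ManPQN algorithm: parameters $\gamma,\sigma\in(0,1)$, integer $m>0$, initial point $X_0\in\mathcal{M}$. For $k=0,1,2,\dots$: given a symmetric positive definite linear operator $\mathcal{B}_k$ on ${\rm T}_{X_k}\mathcal{M}$, with $\|V\|_{\mathcal{B}_k}^2=\langle V,\mathcal{B}_k[V]\rangle$, let $$V_k=\arg\min_{V\in{\rm T}_{X_k}\mathcal{M}}\ \langle\nabla f(X_k),V\rangle+\tfrac12\|V\|_{\mathcal{B}_k}^2+h(X_k+V);$$ set $\alpha_k=\gamma^{N_k}$ where $N_k\ge0$ is the smallest integer such that $$F(\mathbf{R}_{X_k}(\alpha_kV_k))\le\max_{\max\{0,k-m\}\le j\le k}F(X_j)-\tfrac12\sigma\alpha_k\|V_k\|_{\mathcal{B}_k}^2;$$ set $X_{k+1}=\mathbf{R}_{X_k}(\alpha_kV_k)$. Write $l(k)\in\arg\max_{\max\{k-m,0\}\le j\le k}F(X_j)$, so $F(X_{l(k)})=\max_{\max\{k-m,0\}\le j\le k}F(X_j)$. *)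

(* Defs.v *)
From HB Require Import structures.
From mathcomp Require Import all_boot all_order all_algebra.
From mathcomp Require Import all_classical all_reals all_analysis.

Set Implicit Arguments.
Unset Strict Implicit.
Unset Printing Implicit Defensive.

Import Order.TTheory GRing.Theory Num.Theory.
Import numFieldNormedType.Exports.

Local Open Scope classical_set_scope.
Local Open Scope ring_scope.

(* The library norm `|A| on matrices is the max norm (used here only through
   its topology); the Frobenius norm is therefore introduced separately. *)
Definition inner {R : realType} {n r : nat} (A B : 'M[R]_(n, r)) : R :=
  \tr (A^T *m B).

Definition fnorm {R : realType} {n r : nat} (A : 'M[R]_(n, r)) : R :=
  Num.sqrt (inner A A).

(* C^k on an open set U of a finite-dimensional space, k = 0, 1, 2, ...: the
   derivative is handled through its evaluations 'D_v g in all directions. *)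
Fixpoint Ck_on {R : realType} {V W : normedModType R} (k : nat) (U : set V)
    (g : V -> W) : Prop :=
  match k with
  | 0 => forall x, U x -> {for x, continuous g}
  | k'.+1 => (forall x, U x -> differentiable g x) /\
             (forall v : V, Ck_on k' U ('D_v g))
  end.

(* Smoothness of g on a subset A that need not be open: locally, g is the
   restriction to A of a C^oo map defined on an open set. *)
Definition smooth_on {R : realType} {V W : normedModType R} (A : set V)
    (g : V -> W) : Prop :=
  forall x, A x -> exists (U : set V) (G : V -> W),
    [/\ open U, U x, (forall k, Ck_on k U G)
      & forall y, U y -> A y -> g y = G y].

(* E is a linear subspace of R^(n x r) with the induced inner product. Only the
   values of g on E enter the definitions below when x lies in E. *)
Definition grad_on {R : realType} {n r : nat} (E : set 'M[R]_(n, r))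
    (g : 'M[R]_(n, r) -> R) (x : 'M[R]_(n, r)) : 'M[R]_(n, r) :=
  xget 0 [set G | E G /\
    forall V, E V -> 'D_V (g : 'M[R]_(n, r) -> R^o) x = inner G V].

Definition hess_on {R : realType} {n r : nat} (E : set 'M[R]_(n, r))
    (g : 'M[R]_(n, r) -> R) (x U : 'M[R]_(n, r)) : 'M[R]_(n, r) :=
  'D_U (grad_on E g) x.

Definition grad {R : realType} {n r : nat} (g : 'M[R]_(n, r) -> R) :=
  grad_on [set: 'M[R]_(n, r)] g.

Definition eigenvalue_on {R : realType} {n r : nat} (E : set 'M[R]_(n, r))
    (H : 'M[R]_(n, r) -> 'M[R]_(n, r)) (a : R) : Prop :=
  exists V, [/\ E V, V != 0 & H V = a *: V].

(* Extended-real, so that it is +oo when E = 0 and there is no eigenvalue. *)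
Definition lambda_min {R : realType} {n r : nat} (E : set 'M[R]_(n, r))
    (H : 'M[R]_(n, r) -> 'M[R]_(n, r)) : \bar R :=
  ereal_inf [set a%:E | a in eigenvalue_on E H].

Definition stiefel {R : realType} (n r : nat) : set 'M[R]_(n, r) :=
  [set X | X^T *m X = 1%:M].

Definition tangent {R : realType} {n r : nat} (X : 'M[R]_(n, r)) :
    set 'M[R]_(n, r) :=
  [set V | V^T *m X + X^T *m V = 0].

Definition tangent_bundle {R : realType} (n r : nat) :
    set ('M[R]_(n, r) * 'M[R]_(n, r)) :=
  [set XV | stiefel XV.1 /\ tangent XV.1 XV.2].

(* Rt X xi is meaningful only for (X, xi) in the tangent bundle. *)
Definition retraction {R : realType} {n r : nat}
    (Rt : 'M[R]_(n, r) -> 'M[R]_(n, r) -> 'M[R]_(n, r)) : Prop :=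
  [/\ forall X xi, stiefel X -> tangent X xi -> stiefel (Rt X xi),
      smooth_on (@tangent_bundle R n r) (fun XV => Rt XV.1 XV.2),
      forall X, stiefel X -> Rt X 0 = X
    & forall X V, stiefel X -> tangent X V -> is_derive 0 V (Rt X) V].

Definition frob_lipschitz {R : realType} {n r : nat} (c : R)
    (g : 'M[R]_(n, r) -> R) : Prop :=
  forall X Y, `|g X - g Y| <= c * fnorm (X - Y).

Definition frob_lipschitz_mx {R : realType} {n r : nat} (c : R)
    (g : 'M[R]_(n, r) -> 'M[R]_(n, r)) : Prop :=
  forall X Y, fnorm (g X - g Y) <= c * fnorm (X - Y).

Definition grad_bound {R : realType} {n r : nat} (f : 'M[R]_(n, r) -> R) : R :=
  sup [set fnorm (grad f X) | X in @stiefel R n r].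

Definition upsilon {R : realType} (L rho delta : R) : R :=
  (4 * L + 4 * rho + 5 * delta) / delta.

Definition kappa1 {R : realType} (L rho delta : R) (p : nat) : R :=
  let u := upsilon L rho delta in
  ((u ^+ (2 * p) - 1) / (u ^+ 2 - 1) * (4 / delta) + u ^+ (2 * p) / delta)^-1.

Definition kappa2 {R : realType} (L rho delta : R) (p : nat) : R :=
  delta + 4 * (L + rho + delta) ^+ 2 / delta * p%:R.

Definition sqnormB {R : realType} {n r : nat}
    (B : 'M[R]_(n, r) -> 'M[R]_(n, r)) (V : 'M[R]_(n, r)) : R :=
  inner V (B V).

Definition spd_operator_on {R : realType} {n r : nat} (E : set 'M[R]_(n, r))
    (B : 'M[R]_(n, r) -> 'M[R]_(n, r)) : Prop :=
  [/\ forall V, E V -> E (B V),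
      forall a U V, E U -> E V -> B (a *: U + V) = a *: B U + B V,
      forall U V, E U -> E V -> inner U (B V) = inner (B U) V
    & forall V, E V -> V != 0 -> 0 < sqnormB B V].

(* Truncated subtraction on nat: (k - m)%N is max(0, k - m). *)
Definition window_max {R : realType} (m : nat) (u : nat -> R) (k : nat) : R :=
  \big[Num.max/u k]_((k - m)%N <= j < k.+1) u j.

Definition window_argmax {R : realType} (m : nat) (u : nat -> R)
    (k l : nat) : Prop :=
  (k - m <= l <= k)%N /\ forall j, (k - m <= j <= k)%N -> u j <= u l.

Section ManPQN.
Context {R : realType} {n r : nat}.
Variables (f h : 'M[R]_(n, r) -> R).
Variables (Rt : 'M[R]_(n, r) -> 'M[R]_(n, r) -> 'M[R]_(n, r)).
Variables (gamma sigma : R) (m : nat).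

Definition subproblem_obj (B : 'M[R]_(n, r) -> 'M[R]_(n, r))
    (X V : 'M[R]_(n, r)) : R :=
  inner (grad f X) V + 2^-1 * sqnormB B V + h (X + V).

Definition subproblem_argmin B X V : Prop :=
  tangent X V /\
  forall W, tangent X W -> subproblem_obj B X V <= subproblem_obj B X W.

Definition line_search_ok (B : 'M[R]_(n, r) -> 'M[R]_(n, r))
    (X : nat -> 'M[R]_(n, r)) (V : 'M[R]_(n, r)) (k N : nat) : Prop :=
  (f \+ h) (Rt (X k) (gamma ^+ N *: V)) <=
    window_max m (fun j => (f \+ h) (X j)) k
    - 2^-1 * sigma * gamma ^+ N * sqnormB B V.

Definition ManPQN (B : nat -> 'M[R]_(n, r) -> 'M[R]_(n, r))
    (X V : nat -> 'M[R]_(n, r)) (N : nat -> nat) : Prop :=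
  stiefel (X 0%N) /\
  forall k,
    [/\ spd_operator_on (tangent (X k)) (B k),
        subproblem_argmin (B k) (X k) (V k),
        line_search_ok (B k) X (V k) k (N k),
        forall j, (j < N k)%N -> ~ line_search_ok (B k) X (V k) k j
      & X k.+1 = Rt (X k) (gamma ^+ N k *: V k)].

End ManPQN.

(* Main.v *)
Require Import Defs.
From HB Require Import structures.
From mathcomp Require Import all_boot all_order all_algebra.
From mathcomp Require Import all_classical all_reals all_analysis.
From mathcomp Require Import ring lra.

Set Implicit Arguments.
Unset Strict Implicit.
Unset Printing Implicit Defensive.

Import Order.TTheory GRing.Theory Num.Theory.
Import numFieldNormedType.Exports.

Local Open Scope classical_set_scope.
Local Open Scope ring_scope.

(** Write [F = f + h], let [F0] be the value [F X*], [v k] the norm of [V k] and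
    [phi k] the maximum of [F] over the window ending at [k].  The theorem
    follows from two inequalities, valid for large [k]:

    - [F X(k+1) <= phi k - c * v k ^ 2], the sufficient decrease;
    - [F X(k+1) - F0 <= (1 - s) * (phi k - F0) + C * v k ^ 2], with [s > 0].

    A suitable convex combination of the two eliminates [v k] and gives
    [F X(k+1) - F0 <= q * (phi k - F0)] with [q < 1].  After [m + 1] steps the
    window only contains contracted values, so [phi] itself contracts by [q]
    every [m + 1] steps ([window_linear_rate]).

    The first inequality is the line search, once step sizes are bounded below
    ([step_size_lower], [sufficient_decrease]).

    The second one compares the minimiser [V k] of the subproblem at [X = X k]
    with [t *: W], where [W] is a tangent vector at [X] that points to [X*].
    Convexity of [h] makes the linear part of the model scale with [t] and the
    quadratic part with [t ^ 2], so for small [t] the metric is negligible and it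
    is enough that [f X + <grad f X, W> + h (X + W)] lies below [F0] by a multiple
    of the squared distance from [X] to [X*] ([model_decrease]).

    That gap comes from the Hessian hypothesis.  On the tangent space at [X*] the
    pullback of [f] by the retraction is a C2 function; its projected Hessian is
    symmetric, so a lower bound on its eigenvalues bounds its quadratic form
    ([rayleigh_ge]) and Taylor's formula gives
    [f (Rt X* z) >= f X* + <grad f X*, z> + (eta / 2) * |z| ^ 2 - o(|z| ^ 2)]
    ([pullback_lower_bound]).  The explicit second-order comparison of chords,
    tangent vectors and retracted points in [chord_model] moves this estimate to
    every nearby point [X] of the manifold and to the vector [W], without an
    inverse of the retraction.  The price is the second-order error of the
    retraction inside [h], at most [Lh * M2 * |z| ^ 2], which is less than
    [(eta / 2) * |z| ^ 2].

    It remains to see that the iterates stay near [X*].  The classical argument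
    on nonmonotone line searches ([window_limit]) shows that [v] tends to [0] and
    [F (X k)] to [F0]; hence [X*] is stationary ([limit_stationary]), the same
    second-order estimate becomes quadratic growth of [F] around [X*]
    ([quadratic_growth]), and an iterate close to [X*] with small steps and small
    objective cannot leave ([iterates_converge]). *)

(** * The Frobenius inner product and norm *)

Section Frobenius.
Context {R : realType} {n r : nat}.
Implicit Types (A B C : 'M[R]_(n, r)) (a : R).

Lemma innerE A B : inner A B = \sum_i \sum_j A i j * B i j.
Proof.
rewrite /inner /mxtrace exchange_big /=; apply: eq_bigr => j _.
by rewrite mxE; apply: eq_bigr => i _; rewrite mxE.
Qed.

Lemma innerC A B : inner A B = inner B A.
Proof.
by rewrite !innerE; apply: eq_bigr => i _; apply: eq_bigr => j _; rewrite mulrC.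
Qed.

Lemma innerDr A B C : inner A (B + C) = inner A B + inner A C.
Proof. by rewrite /inner mulmxDr mxtraceD. Qed.

Lemma innerZr a A B : inner A (a *: B) = a * inner A B.
Proof. by rewrite /inner -scalemxAr mxtraceZ. Qed.

Lemma innerNr A B : inner A (- B) = - inner A B.
Proof. by rewrite -scaleN1r innerZr mulN1r. Qed.

Lemma innerBr A B C : inner A (B - C) = inner A B - inner A C.
Proof. by rewrite innerDr innerNr. Qed.

Lemma innerDl A B C : inner (A + B) C = inner A C + inner B C.
Proof. by rewrite innerC innerDr !(innerC C). Qed.

Lemma innerZl a A B : inner (a *: A) B = a * inner A B.
Proof. by rewrite innerC innerZr innerC. Qed.

Lemma innerNl A B : inner (- A) B = - inner A B.
Proof. by rewrite innerC innerNr innerC. Qed.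

Lemma innerBl A B C : inner (A - B) C = inner A C - inner B C.
Proof. by rewrite innerDl innerNl. Qed.

Lemma inner0r A : inner A 0 = 0.
Proof. by rewrite /inner mulmx0 mxtrace0. Qed.

Lemma inner0l A : inner 0 A = 0.
Proof. by rewrite innerC inner0r. Qed.

Lemma inner_ge0 A : 0 <= inner A A.
Proof.
by rewrite innerE; do 2! (apply: sumr_ge0 => ? _); rewrite -expr2 sqr_ge0.
Qed.

Lemma inner_eq0 A : inner A A = 0 -> A = 0.
Proof.
rewrite innerE => /eqP; rewrite psumr_eq0; last first.
  by move=> i _; apply: sumr_ge0 => j _; rewrite -expr2 sqr_ge0.
move=> /allP A0; apply/matrixP => i j; rewrite mxE.
move: (A0 i (mem_index_enum _)); rewrite /= psumr_eq0; last first.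
  by move=> k _; rewrite -expr2 sqr_ge0.
move=> /allP /(_ j (mem_index_enum _)) /=.
by rewrite -expr2 sqrf_eq0 => /eqP.
Qed.

Lemma fnorm_ge0 A : 0 <= fnorm A.
Proof. exact: sqrtr_ge0. Qed.

Lemma fnorm_sqr A : fnorm A ^+ 2 = inner A A.
Proof. by rewrite sqr_sqrtr // inner_ge0. Qed.

Lemma fnorm0 : fnorm (0 : 'M[R]_(n, r)) = 0.
Proof. by rewrite /fnorm inner0r sqrtr0. Qed.

Lemma fnorm_eq0 A : fnorm A = 0 -> A = 0.
Proof. by move=> A0; apply: inner_eq0; rewrite -fnorm_sqr A0 expr0n. Qed.

Lemma fnorm_gt0 A : A != 0 -> 0 < fnorm A.
Proof.
move=> An0; rewrite lt_neqAle fnorm_ge0 andbT eq_sym.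
by apply: contra_neq An0 => /fnorm_eq0.
Qed.

Lemma fnormZ a A : fnorm (a *: A) = `|a| * fnorm A.
Proof.
rewrite /fnorm innerZl innerZr mulrA -expr2 sqrtrM ?sqr_ge0 //.
by rewrite sqrtr_sqr.
Qed.

Lemma fnormN A : fnorm (- A) = fnorm A.
Proof. by rewrite -scaleN1r fnormZ normrN1 mul1r. Qed.

Lemma fnormB A B : fnorm (A - B) = fnorm (B - A).
Proof. by rewrite -fnormN opprB. Qed.

Lemma inner_le_fnorm A B : inner A B <= fnorm A * fnorm B.
Proof.
have [->|A0] := eqVneq A 0; first by rewrite inner0l fnorm0 mul0r.
have [->|B0] := eqVneq B 0; first by rewrite inner0r fnorm0 mulr0.
have a0 := fnorm_gt0 A0; have b0 := fnorm_gt0 B0.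
have := inner_ge0 (fnorm B *: A - fnorm A *: B).
rewrite innerBl !innerBr !innerZl !innerZr -!fnorm_sqr (innerC B A).
move: (fnorm A) (fnorm B) (inner A B) a0 b0 => a b c a0 b0 H.
have : 0 <= (2 * (a * b)) * (a * b - c).
  by apply: (le_trans H); rewrite le_eqVlt; apply/orP; left; apply/eqP; ring.
by rewrite pmulr_rge0 ?subr_ge0 // !mulr_gt0.
Qed.

Lemma norm_inner_le A B : `|inner A B| <= fnorm A * fnorm B.
Proof.
rewrite ler_norml inner_le_fnorm andbT lerNl -innerNl.
by rewrite (le_trans (inner_le_fnorm _ _)) // fnormN.
Qed.

Lemma fnormD A B : fnorm (A + B) <= fnorm A + fnorm B.
Proof.
rewrite -(@ler_pXn2r _ 2) // ?nnegrE ?addr_ge0 ?fnorm_ge0 //.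
rewrite fnorm_sqr innerDl !innerDr -!fnorm_sqr (innerC B A).
have := inner_le_fnorm A B; nra.
Qed.

Lemma fnormBD A B : fnorm (A - B) <= fnorm A + fnorm B.
Proof. by rewrite (le_trans (fnormD _ _)) // fnormN. Qed.

Lemma fnorm_split A B C : fnorm (A - C) <= fnorm (A - B) + fnorm (B - C).
Proof. by rewrite (le_trans _ (fnormD _ _)) // addrA subrK. Qed.

Lemma fnorm_trmx A : fnorm A^T = fnorm A.
Proof. by rewrite /fnorm /inner trmxK mxtrace_mulC. Qed.

Lemma norm_entry_le_fnorm A i j : `|A i j| <= fnorm A.
Proof.
rewrite -(@ler_pXn2r _ 2) // ?nnegrE ?normr_ge0 ?fnorm_ge0 //.
rewrite fnorm_sqr innerE (bigD1 i) //= (bigD1 j) //= real_normK ?num_real //.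
rewrite -expr2 -addrA lerDl addr_ge0 //; last first.
  by do 2! (apply: sumr_ge0 => ? _); rewrite -expr2 sqr_ge0.
by apply: sumr_ge0 => ? _; rewrite -expr2 sqr_ge0.
Qed.

Lemma mxnorm_le_fnorm A : `|A| <= fnorm A.
Proof.
rewrite /Num.norm /= mx_normrE; apply: bigmax_le; first exact: fnorm_ge0.
by move=> [i j] _; exact: norm_entry_le_fnorm.
Qed.

Lemma norm_entry_le_mxnorm A i j : `|A i j| <= `|A|.
Proof.
rewrite [leRHS]/Num.norm /= mx_normrE.
exact: (le_bigmax _ (fun ij : 'I_n * 'I_r => `|A ij.1 ij.2|) (i, j)).
Qed.

Lemma fnorm_le_mxnorm A : fnorm A <= (n * r).+1%:R * `|A|.
Proof.
rewrite -(@ler_pXn2r _ 2) // ?nnegrE ?mulr_ge0 ?normr_ge0 ?fnorm_ge0 //.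
rewrite fnorm_sqr innerE exprMn.
apply: (@le_trans _ _ ((n * r)%:R * `|A| ^+ 2)).
  apply: (@le_trans _ _ (\sum_(i < n) \sum_(j < r) `|A| ^+ 2)).
    apply: ler_sum => i _; apply: ler_sum => j _.
    rewrite -expr2 -(real_normK (num_real (A i j))).
    by rewrite ler_pXn2r ?nnegrE // norm_entry_le_mxnorm.
  rewrite (eq_bigr (fun=> `|A| ^+ 2 *+ r)) => [|i _].
    by rewrite sumr_const card_ord -mulrnA mulnC mulr_natl.
  by rewrite sumr_const card_ord.
rewrite ler_wpM2r ?sqr_ge0 // -natrX ler_nat.
by rewrite (leq_trans (leqnSn _)) // -mulnn leq_pmull.
Qed.

End Frobenius.

Lemma fnorm_mulmx {R : realType} {n k r : nat} (A : 'M[R]_(n, k))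
  (B : 'M[R]_(k, r)) : fnorm (A *m B) <= fnorm A * fnorm B.
Proof.
rewrite -(@ler_pXn2r _ 2) // ?nnegrE ?mulr_ge0 ?fnorm_ge0 //.
rewrite exprMn !fnorm_sqr.
rewrite innerE (innerE A A) mulr_suml; apply: ler_sum => i _.
rewrite (innerE B B) exchange_big mulr_sumr; apply: ler_sum => j _.
rewrite -expr2.
have H := norm_inner_le (row i A)^T (col j B).
rewrite -ler_sqr ?nnegrE ?mulr_ge0 ?fnorm_ge0 // in H.
move: H; rewrite real_normK ?num_real // exprMn !fnorm_sqr !innerE.
have sum1 (u v : 'M[R]_(k, 1)) :
    \sum_i \sum_j u i j * v i j = \sum_i u i 0 * v i 0.
  by apply: eq_bigr => l _; rewrite big_ord1.
rewrite !sum1 => H; apply: le_trans (le_trans H _).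
  rewrite le_eqVlt; apply/orP; left; apply/eqP; congr (_ ^+ 2).
  by rewrite mxE; apply: eq_bigr => l _; rewrite !mxE.
rewrite le_eqVlt; apply/orP; left; apply/eqP.
by congr (_ * _); apply: eq_bigr => l _; rewrite !mxE.
Qed.

(** * Geometry of the Stiefel manifold *)

Section Stiefel.
Context {R : realType} {n r : nat}.
Implicit Types (X Y A B V W : 'M[R]_(n, r)) (a : R).

Lemma fnorm_stiefel_mul X (M : 'M[R]_r) :
  stiefel X -> fnorm (X *m M) = fnorm M.
Proof.
move=> XX; rewrite /fnorm /inner trmx_mul mulmxA -(mulmxA M^T) XX.
by rewrite mulmx1.
Qed.

Lemma tangent0 X : tangent X 0.
Proof. by rewrite /tangent /= trmx0 mul0mx mulmx0 addr0. Qed.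

Lemma tangentZ X a V : tangent X V -> tangent X (a *: V).
Proof.
rewrite /tangent /= => XV.
by rewrite linearZ /= -scalemxAl -scalemxAr -scalerDr XV scaler0.
Qed.

Lemma tangentD X V W : tangent X V -> tangent X W -> tangent X (V + W).
Proof.
rewrite /tangent /= => XV XW.
by rewrite linearD /= mulmxDl mulmxDr addrACA XV XW addr0.
Qed.

Lemma tangentB X V W : tangent X V -> tangent X W -> tangent X (V - W).
Proof. by move=> XV XW; rewrite -scaleN1r; apply/tangentD/tangentZ. Qed.

(** The orthogonal projection onto the tangent space at a point of the
    manifold. *)
Definition tproj X A : 'M[R]_(n, r) :=
  A - 2^-1 *: (X *m (X^T *m A + A^T *m X)).

Lemma tprojD X A B : tproj X (A + B) = tproj X A + tproj X B.
Proof.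
rewrite /tproj (mulmxDr X^T) [(A + B)^T]linearD /= mulmxDl addrACA.
by rewrite (mulmxDr X (_ *m A + _)) scalerDr opprD addrACA.
Qed.

Lemma tprojZ X a A : tproj X (a *: A) = a *: tproj X A.
Proof.
rewrite /tproj [(a *: A)^T]linearZ /= -scalemxAr -scalemxAl -scalerDr -scalemxAr.
by rewrite scalerBr !scalerA mulrC.
Qed.

Lemma tprojB X A B : tproj X (A - B) = tproj X A - tproj X B.
Proof. by rewrite -scaleN1r tprojD tprojZ scaleN1r. Qed.

Lemma tproj_tangent X A : stiefel X -> tangent X (tproj X A).
Proof.
rewrite /stiefel /tangent /tproj /= => XX.
rewrite linearB /= linearZ /= trmx_mul linearD /= !trmx_mul !trmxK.
rewrite mulmxBl mulmxBr -scalemxAl -scalemxAr -mulmxA XX mulmx1.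
rewrite mulmxA XX mul1mx.
rewrite (addrC (A^T *m X) (X^T *m A)) addrACA -opprD -scalerDl.
have -> : (2^-1 + 2^-1 : R) = 1 by lra.
by rewrite scale1r [X in X - _]addrC subrr.
Qed.

Lemma tproj_id X V : tangent X V -> tproj X V = V.
Proof.
by rewrite /tangent /tproj /= => XV; rewrite addrC in XV; rewrite XV
  mulmx0 scaler0 subr0.
Qed.

Lemma inner_tproj X A V : tangent X V -> inner (tproj X A) V = inner A V.
Proof.
rewrite /tangent /tproj /= => XV; rewrite innerBl innerZl.
set S := X^T *m A + A^T *m X.
suff : inner (X *m S) V = 0 by move=> ->; rewrite mulr0 subr0.
have St : S^T = S by rewrite /S linearD /= !trmx_mul !trmxK addrC.
have XVE : V^T *m X = - (X^T *m V) by apply/eqP; rewrite -addr_eq0 XV.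
have E1 : inner (X *m S) V = \tr (S *m (X^T *m V)).
  by rewrite /inner trmx_mul St mulmxA.
have E2 : inner (X *m S) V = - \tr (S *m (X^T *m V)).
  by rewrite innerC /inner mulmxA XVE mulNmx raddfN /= mxtrace_mulC.
by move: E1 E2; set x := inner _ _; set y := \tr _; lra.
Qed.

(** Both endpoints have orthonormal columns, which determines the symmetric part
    of [X^T *m (Y - X)]: the normal component of a chord is quadratic in its
    length. *)
Lemma tproj_chord X Y : stiefel X -> stiefel Y ->
  tproj X (Y - X) = (Y - X) + 2^-1 *: (X *m ((Y - X)^T *m (Y - X))).
Proof.
rewrite /stiefel /tproj /= => XX YY.
suff -> : X^T *m (Y - X) + (Y - X)^T *m X = - ((Y - X)^T *m (Y - X)).
  by rewrite mulmxN scalerN opprK.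
rewrite [(Y - X)^T]linearB /= !mulmxBl !mulmxBr XX YY.
apply/matrixP => i j; rewrite !mxE; set a := \sum_(k < n) _.
set b := \sum_(k < n) _; ring.
Qed.

(** A tangent vector at [X0] is nearly tangent at a nearby [X], because its
    symmetric part against [X] only sees [X - X0]. *)
Lemma tproj_transport X X0 T : stiefel X -> tangent X0 T ->
  fnorm (tproj X T - T) <= fnorm (X - X0) * fnorm T.
Proof.
move=> XX; rewrite /tangent /tproj /= => XT.
rewrite addrC addKr fnormN fnormZ fnorm_stiefel_mul //.
have -> : X^T *m T + T^T *m X = (X - X0)^T *m T + T^T *m (X - X0).
  rewrite linearB /= mulmxBl mulmxBr addrACA -opprD [X in _ - X]addrC.
  by rewrite XT subr0.
rewrite ger0_norm ?invr_ge0 //.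
have H1 := fnorm_mulmx (X - X0)^T T; have H2 := fnorm_mulmx T^T (X - X0).
rewrite !fnorm_trmx in H1 H2.
have := fnormD ((X - X0)^T *m T) (T^T *m (X - X0)).
by rewrite (mulrC (fnorm T)) in H2; lra.
Qed.

End Stiefel.

(** * Second-order calculus in the Frobenius norm *)

Section Calculus.
Context {R : realType} {n r : nat}.
Local Notation mat := 'M[R]_(n, r).
Implicit Types (x y e v u w A B : mat) (g : mat -> R^o).

(** The topology of matrices is that of the entrywise maximum norm, which is
    equivalent to the Frobenius norm; from here on neighbourhoods are Frobenius
    balls. *)
Lemma nbhs_fnormP x (P : mat -> Prop) :
  (\forall y \near x, P y) <->
  exists2 d, 0 < d & forall y, fnorm (y - x) <= d -> P y.
Proof.
split.
  move=> /nbhs_ballP [d /= d0 dP]; exists (d / 2); first by rewrite divr_gt0.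
  move=> y yx; apply: dP; rewrite mx_norm_ball /ball_ /= distrC.
  by apply: (le_lt_trans (mxnorm_le_fnorm _)); apply: (le_lt_trans yx); lra.
move=> [d d0 dP]; apply/nbhs_ballP.
have N0 : 0 < (n * r).+1%:R :> R by rewrite ltr0n.
exists (d / (n * r).+1%:R) => /=; first by rewrite divr_gt0.
move=> y; rewrite mx_norm_ball /ball_ /= distrC => yx; apply: dP.
apply: (le_trans (fnorm_le_mxnorm _)); rewrite mulrC -ler_pdivlMr //.
exact: ltW.
Qed.

Lemma line_derive (W : normedModType R) (g : mat -> W) x e (t : R) :
  'D_1 (fun s : R => g (x + s *: e)) t = 'D_e g (x + t *: e).
Proof.
rewrite /derive; set q := fun h => _; set q' := fun h => _.
suff -> : q = q' by [].
apply/funext => h /=; rewrite /q /q' /= /shift /=.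
by rewrite scalerDl [h *: 1]mulr1 addrCA.
Qed.

Lemma line_derivable (W : normedModType R) (g : mat -> W) x e (t : R) :
  derivable g (x + t *: e) e -> derivable (fun s : R => g (x + s *: e)) t 1.
Proof.
rewrite /derivable; set q := fun h => _; set q' := fun h => _.
suff -> : q = q' by [].
apply/funext => h /=; rewrite /q /q' /= /shift /=.
by rewrite scalerDl [h *: 1]mulr1 addrCA.
Qed.

Lemma line_is_derive g x e (t : R) : differentiable g (x + t *: e) ->
  is_derive t 1 (fun s : R => g (x + s *: e)) ('D_e g (x + t *: e)).
Proof.
move=> gd; split; last exact: line_derive.
exact/line_derivable/diff_derivable.
Qed.

Lemma derive_inner g y v : differentiable g y ->
  'D_v g y = inner (\matrix_(i, j) 'D_(delta_mx i j) g y) v.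
Proof.
move=> gd; rewrite deriveE // {1}(matrix_sum_delta v) innerE linear_sum /=.
apply: eq_bigr => i _; rewrite linear_sum /=; apply: eq_bigr => j _.
by rewrite linearZ /= mxE deriveE // mulrC.
Qed.

Lemma grad_on_eq (E : set mat) g x G :
  (forall A B, E A -> E B -> E (A - B)) -> E G ->
  (forall V, E V -> 'D_V g x = inner G V) -> grad_on E g x = G.
Proof.
move=> EB EG DG; rewrite /grad_on; case: xgetP => [G' _ [EG' DG']|/(_ G) /= []//].
apply/eqP; rewrite -subr_eq0; apply/eqP/inner_eq0.
by rewrite innerBl -DG' -?DG ?subrr //; exact: EB.
Qed.

Lemma gradE g y : differentiable g y ->
  grad g y = \matrix_(i, j) 'D_(delta_mx i j) g y.
Proof. by move=> gd; apply: grad_on_eq => // V _; exact: derive_inner. Qed.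

Lemma derive_grad g y v : differentiable g y -> 'D_v g y = inner (grad g y) v.
Proof. by move=> gd; rewrite gradE // derive_inner. Qed.

Lemma differentiable_fnormP (g : mat -> R^o) x (eps : R) :
  differentiable g x -> 0 < eps ->
  exists2 d, 0 < d & forall e, fnorm e <= d ->
    `|g (x + e) - g x - 'D_e g x| <= eps * fnorm e.
Proof.
move=> gd e0; have /diff_locallyP[_ /eqaddoP /(_ _ e0)] := gd.
move=> /nbhs_fnormP [d d0 H]; exists d => // e ed.
have := H e; rewrite subr0 => /(_ ed) h.
rewrite deriveE // -addrA -opprD (addrC x e).
by apply: le_trans h _; rewrite ler_wpM2l ?(ltW e0) // mxnorm_le_fnorm.
Qed.

(** Near [x] the function is differentiable, and its gradient is differentiable
    at [x]: exactly what Young's theorem and the second-order Taylor expansion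
    at [x] use. *)
Definition twice_diff g x :=
  (\forall y \near x, differentiable g y) /\
  forall v, differentiable ('D_v g : mat -> R^o) x.

(** Locked, since unification would otherwise compare limits of difference
    quotients when two increments differ. *)
Fact hessian_key : unit. Proof. by []. Qed.
Definition hessian := locked_with hessian_key
  (fun g x e => \matrix_(i, j) 'D_e ('D_(delta_mx i j) g : mat -> R^o) x : mat).

Lemma hessianE g x e i j :
  hessian g x e i j = 'D_e ('D_(delta_mx i j) g : mat -> R^o) x.
Proof. by rewrite /hessian unlock mxE. Qed.

Lemma hessian_diff g x e i j : twice_diff g x ->
  hessian g x e i j = 'd ('D_(delta_mx i j) g : mat -> R^o) x e.
Proof. by move=> [_ gd]; rewrite hessianE deriveE. Qed.

Lemma hessianD g x u w : twice_diff g x ->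
  hessian g x (u + w) = hessian g x u + hessian g x w.
Proof.
move=> g2; apply/matrixP => i j; rewrite [RHS]mxE.
by rewrite !(hessian_diff _ _ _ g2) linearD.
Qed.

Lemma hessianZ g x (a : R) u : twice_diff g x ->
  hessian g x (a *: u) = a *: hessian g x u.
Proof.
move=> g2; apply/matrixP => i j; rewrite [RHS]mxE.
by rewrite !(hessian_diff _ _ _ g2) linearZ.
Qed.

Lemma twice_diff_ball g x : twice_diff g x ->
  exists2 d, 0 < d & forall y, fnorm (y - x) <= d -> differentiable g y.
Proof. by case=> /nbhs_fnormP. Qed.

Lemma hessian_linear g x : twice_diff g x -> linear (hessian g x).
Proof. by move=> g2 a u w; rewrite hessianD // hessianZ. Qed.

Lemma grad_expansion g x (eps : R) : twice_diff g x -> 0 < eps ->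
  exists2 d, 0 < d & forall e, fnorm e <= d ->
    fnorm (grad g (x + e) - grad g x - hessian g x e) <= eps * fnorm e.
Proof.
move=> [gd g2] e0; have N0 : 0 < (n * r).+1%:R :> R by rewrite ltr0n.
have gdx : differentiable g x := nbhs_singleton gd.
have : \forall y \near x, differentiable g y /\ forall ij : 'I_n * 'I_r,
    `|'D_(delta_mx ij.1 ij.2) g y - 'D_(delta_mx ij.1 ij.2) g x
      - 'D_(y - x) ('D_(delta_mx ij.1 ij.2) g : mat -> R^o) x|
    <= eps / (n * r).+1%:R * fnorm (y - x).
  near=> y; split; first by near: y.
  near: y; apply: filter_forall => ij.
  apply/nbhs_fnormP.
  have [d d0 H] := differentiable_fnormP (g2 (delta_mx ij.1 ij.2))
    (divr_gt0 e0 N0).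
  by exists d => // y /H; rewrite [x + _]addrC subrK.
move=> /nbhs_fnormP [d d0 H]; exists d => // e ed.
have := H (x + e); rewrite [x + e - x]addrC addKr => /(_ ed) [gdy {}H].
rewrite (le_trans (fnorm_le_mxnorm _)) // mulrC -ler_pdivlMr //.
rewrite /Num.norm /= mx_normrE; apply: bigmax_le.
  by rewrite !mulr_ge0 ?fnorm_ge0 ?invr_ge0 ?(ltW e0).
move=> [i j] _ /=; rewrite !gradE // !mxE hessianE mulrAC; exact: (H (i, j)).
Unshelve. all: by end_near. Qed.

(** [G] is the gradient of [g] near [x] and [H] is the derivative of [G] at [x].
    Keeping the two as parameters lets the expansions below serve both for [f]
    and for its pullback by the retraction. *)
Definition second_order_data g x (G H : mat -> mat) :=
  [/\ exists2 d, 0 < d & forall y, fnorm (y - x) <= d ->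
       differentiable g y /\ forall v, 'D_v g y = inner (G y) v,
      linear H
    & forall eps : R, 0 < eps -> exists2 d, 0 < d & forall e, fnorm e <= d ->
       fnorm (G (x + e) - G x - H e) <= eps * fnorm e].

Lemma twice_diff_data g x :
  twice_diff g x -> second_order_data g x (grad g) (hessian g x).
Proof.
move=> g2; split; last by move=> eps; exact: grad_expansion.
  have [d d0 gd] := twice_diff_ball g2; exists d => // y /gd gdy; split=> //.
  by move=> v; exact: derive_grad.
exact: hessian_linear.
Qed.

Lemma linear_scale (H : mat -> mat) a u : linear H -> H (a *: u) = a *: H u.
Proof.
move=> Hlin; have H0 : H 0 = 0.
  by have := Hlin (-1) 0 0; rewrite !scaleN1r !addNr.
by have := Hlin a u 0; rewrite !addr0 H0 addr0.
Qed.

Lemma linear_add (H : mat -> mat) u w : linear H -> H (u + w) = H u + H w.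
Proof. by move=> /(_ 1 u w); rewrite !scale1r. Qed.

Lemma mvt01 (psi dpsi : R -> R) :
  (forall t : R, t \in `[0, 1] -> is_derive t 1 psi (dpsi t)) ->
  exists2 c : R, c \in `[0, 1] & psi 1 - psi 0 = dpsi c.
Proof.
move=> dP.
have cpsi : {within `[0, 1], continuous psi}.
  apply: derivable_within_continuous => t t01.
  by have [] := dP t t01.
have dP' (t : R) : t \in `]0, 1[ -> is_derive t 1 psi (dpsi t).
  by rewrite in_itv /= => /andP[t0 t1]; apply: dP; rewrite in_itv /= !ltW.
have [c c01] := MVT_segment ler01 dP' cpsi.
by rewrite subr0 mulr1 => E; exists c.
Qed.

Lemma mvt_segment g (G : mat -> mat) x e :
  (forall t : R, t \in `[0, 1] -> differentiable g (x + t *: e) /\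
     forall v, 'D_v g (x + t *: e) = inner (G (x + t *: e)) v) ->
  exists2 c : R, c \in `[0, 1] & g (x + e) - g x = inner (G (x + c *: e)) e.
Proof.
move=> gG; have gd (t : R) : t \in `[0, 1] -> differentiable g (x + t *: e).
  by case/gG.
have [c c01 E] := @mvt01 (fun t : R => g (x + t *: e))
  (fun t => 'D_e g (x + t *: e)) (fun t t01 => line_is_derive (gd t t01)).
exists c => //; have [_ <-] := gG c c01.
by move: E; rewrite scale1r scale0r addr0.
Qed.

Lemma taylor2 g x G H (eps : R) : second_order_data g x G H -> 0 < eps ->
  exists2 d, 0 < d & forall e, fnorm e <= d ->
    `|g (x + e) - g x - inner (G x) e - 2^-1 * inner (H e) e|
    <= eps * fnorm e ^+ 2.
Proof.
move=> [[d1 d10 gd] Hlin GH] e0; have [d2 d20 {}GH] := GH _ e0.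
exists (Num.min d1 d2) => [|e]; rewrite ?lt_min ?d10 // le_min => /andP[ed1 ed2].
have te (t : R) : t \in `[0, 1] -> fnorm (t *: e) <= fnorm e.
  rewrite in_itv /= => /andP[t0 t1].
  by rewrite fnormZ ger0_norm // ler_piMl ?fnorm_ge0.
have gdt (t : R) : t \in `[0, 1] -> differentiable g (x + t *: e) /\
    forall v, 'D_v g (x + t *: e) = inner (G (x + t *: e)) v.
  move=> t01; apply: gd; rewrite addrC addKr.
  exact: (le_trans (te t t01)).
pose psi (t : R) : R := g (x + t *: e) - t * inner (G x) e
   - t ^+ 2 * (2^-1 * inner (H e) e).
pose dpsi (t : R) : R := inner (G (x + t *: e) - G x - t *: H e) e.
have dP (t : R) : t \in `[0, 1] -> is_derive t 1 psi (dpsi t).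
  move=> t01; have [gdx DG] := gdt t t01; have L := line_is_derive gdx.
  rewrite /psi; apply: is_derive_eq.
  rewrite /dpsi !innerBl innerZl DG /GRing.scale /=.
  move: (inner (G (x + _)) e) (inner (G x) e) => a b.
  by move: (inner (H e) e) => c; field.
have [c c01] := mvt01 dP.
rewrite /psi scale1r scale0r addr0 expr1n expr0n /= !mul0r !mul1r !subr0.
move=> E.
have -> : g (x + e) - g x - inner (G x) e - 2^-1 * inner (H e) e = dpsi c.
  by rewrite -E; ring.
apply: (le_trans (norm_inner_le _ _)); rewrite expr2 mulrA.
rewrite ler_wpM2r ?fnorm_ge0 // -(linear_scale _ _ Hlin).
apply: le_trans (GH _ (le_trans (te c c01) ed2)) _.
by rewrite ler_wpM2l ?te ?(ltW e0).
Qed.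

(** The mean value theorem along [w] turns the second difference into an
    increment of the gradient along [u]. *)
Lemma second_difference g x G H (eps : R) :
  second_order_data g x G H -> 0 < eps ->
  exists2 d, 0 < d & forall u w, fnorm u + fnorm w <= d ->
    `|(g (x + u + w) - g (x + u)) - (g (x + w) - g x) - inner (H u) w|
    <= eps * (fnorm u + fnorm w) ^+ 2.
Proof.
move=> [[d1 d10 gd] Hlin GH] e0; have e20 : 0 < eps / 2 by rewrite divr_gt0.
have [d2 d20 {}GH] := GH _ e20.
exists (Num.min d1 d2) => [|u w]; rewrite ?lt_min ?d10 // le_min => /andP[uw1 uw2].
have u0 := fnorm_ge0 u; have w0 := fnorm_ge0 w.
have tw (t : R) : t \in `[0, 1] -> fnorm (t *: w) <= fnorm w.
  rewrite in_itv /= => /andP[t0 t1].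
  by rewrite fnormZ ger0_norm // ler_piMl ?fnorm_ge0.
have utw (t : R) : t \in `[0, 1] -> fnorm (u + t *: w) <= fnorm u + fnorm w.
  by move=> t01; rewrite (le_trans (fnormD _ _)) // lerD2l tw.
have gdt (t : R) : t \in `[0, 1] -> differentiable g (x + t *: w) /\
    forall v, 'D_v g (x + t *: w) = inner (G (x + t *: w)) v.
  move=> t01; apply: gd; rewrite addrC addKr.
  by have := tw t t01; lra.
have gdut (t : R) : t \in `[0, 1] -> differentiable g (x + u + t *: w) /\
    forall v, 'D_v g (x + u + t *: w) = inner (G (x + u + t *: w)) v.
  move=> t01; apply: gd; rewrite -(addrA x) [x + _]addrC addrK.
  by have := utw t t01; lra.
pose psi (t : R) : R := g (x + u + t *: w) - g (x + t *: w).
pose dpsi (t : R) : R := inner (G (x + u + t *: w) - G (x + t *: w)) w.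
have dP (t : R) : t \in `[0, 1] -> is_derive t 1 psi (dpsi t).
  move=> t01; have [gdx DG] := gdt t t01; have [gdy DG'] := gdut t t01.
  have L := line_is_derive gdx; have L' := line_is_derive gdy.
  rewrite /psi; apply: is_derive_eq.
  by rewrite /dpsi !innerBl DG DG'.
have [c c01] := mvt01 dP.
rewrite /psi !scale1r !scale0r !addr0 => E.
have -> : (g (x + u + w) - g (x + u)) - (g (x + w) - g x)
    = dpsi c by rewrite -E; ring.
rewrite /dpsi -innerBl.
set A := G (x + (u + c *: w)) - G x - H (u + c *: w).
set B := G (x + c *: w) - G x - H (c *: w).
have -> : G (x + u + c *: w) - G (x + c *: w) - H u = A - B.
  rewrite /A /B (linear_add _ _ Hlin) (addrA x).
  move: (G _) (G _) (G _) (H _) (H _) => a b k l m.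
  apply/matrixP => i j; rewrite !mxE; ring.
apply: (le_trans (norm_inner_le _ _)).
have HA : fnorm A <= eps / 2 * (fnorm u + fnorm w).
  apply: le_trans (GH _ _) _; first by have := utw c c01; lra.
  by rewrite ler_wpM2l ?utw ?(ltW e20).
have HB : fnorm B <= eps / 2 * (fnorm u + fnorm w).
  apply: le_trans (GH _ _) _; first by have := tw c c01; lra.
  by rewrite ler_wpM2l ?(ltW e20) //; have := tw c c01; lra.
have HAB := fnormBD A B.
have AB : fnorm (A - B) <= eps * (fnorm u + fnorm w) by lra.
rewrite expr2 mulrA ler_pM ?fnorm_ge0 //; lra.
Qed.

(** Young's theorem: the second difference is symmetric in its two increments,
    and after rescaling them it determines the mixed second derivative. *)
Lemma hessian_sym g x G H u w : second_order_data g x G H ->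
  inner (H u) w = inner (H w) u.
Proof.
move=> gGH; have [_ Hlin _] := gGH.
apply/eqP; rewrite -subr_eq0 -normr_le0; apply/ler_addgt0Pr => e e0.
rewrite add0r; set k := (fnorm u + fnorm w) ^+ 2.
have k0 : 0 <= k by rewrite sqr_ge0.
pose eps := e / (2 * (k + 1)).
have eps0 : 0 < eps by rewrite divr_gt0 //; lra.
have [d d0 D] := second_difference gGH eps0.
have s0 : 0 < fnorm u + fnorm w + 1.
  by have := fnorm_ge0 u; have := fnorm_ge0 w; lra.
pose t := d / (fnorm u + fnorm w + 1).
have t0 : 0 < t by rewrite divr_gt0.
have td : t * (fnorm u + fnorm w) <= d.
  rewrite /t mulrAC ler_pdivrMr // ler_wpM2l ?(ltW d0) //; lra.
have eE : e = eps * (2 * (k + 1)) by rewrite /eps divfK // gt_eqF //; lra.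
clearbody t eps.
have nt v : fnorm (t *: v) = t * fnorm v by rewrite fnormZ gtr0_norm.
have Hu : fnorm (t *: u) + fnorm (t *: w) <= d by rewrite !nt -mulrDr.
have Hw : fnorm (t *: w) + fnorm (t *: u) <= d by rewrite addrC.
have := D _ _ Hu; have := D _ _ Hw; rewrite !nt -!mulrDr !exprMn.
rewrite !(linear_scale _ _ Hlin) !innerZl !innerZr (addrAC x (t *: w)).
rewrite (addrC (fnorm w)) -/k.
set a := inner _ u; set b := inner _ w.
move=> Ha Hb; have t20 : 0 < t ^+ 2 by rewrite exprn_gt0.
have K : `|t ^+ 2 * (b - a)| <= t ^+ 2 * e.
  have ek : 2 * (eps * (t ^+ 2 * k)) <= t ^+ 2 * e.
    rewrite eE; have := mulr_gt0 eps0 t20.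
    by move: (eps) (t ^+ 2) (k) => a1 b1 c1; lra.
  move: Ha Hb; rewrite !ler_norml.
  move=> /andP[? ?] /andP[? ?]; apply/andP; split; lra.
by move: K; rewrite normrM gtr0_norm // ler_pM2l.
Qed.

End Calculus.

(** * Eigenvalues and the quadratic form of a symmetric operator *)

Section Rayleigh.
Context {R : realType} {n r : nat}.
Local Notation mat := 'M[R]_(n, r).
Implicit Types (x y e v u w A B : mat).

Lemma fnorm_dist A B : `|fnorm A - fnorm B| <= fnorm (A - B).
Proof.
have := fnorm_split A B 0; have := fnorm_split B A 0; rewrite !subr0 (fnormB B).
by move=> ? ?; rewrite ler_norml; apply/andP; split; lra.
Qed.

Lemma linear_fnorm_bound (H : mat -> mat) : linear H ->
  exists2 C, 0 <= C & forall A, fnorm (H A) <= C * fnorm A.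
Proof.
move=> Hlin; pose HL := GRing.isLinear.Build _ _ _ _ _ Hlin.
pose L : {linear mat -> mat} := HB.pack H HL.
exists (\sum_i \sum_j fnorm (H (delta_mx i j))).
  by do 2! (apply: sumr_ge0 => ? _); exact: fnorm_ge0.
move=> A; rewrite -[H]/(L : mat -> mat) {1}(matrix_sum_delta A).
have Fsum I (s : seq I) (F : I -> mat) :
    fnorm (\sum_(i <- s) F i) <= \sum_(i <- s) fnorm (F i).
  elim: s => [|a s IH]; first by rewrite !big_nil fnorm0.
  by rewrite !big_cons (le_trans (fnormD _ _)) // lerD2l.
rewrite (linear_sum L) mulr_suml; apply: le_trans (Fsum _ _ _) _.
apply: ler_sum => i _; rewrite (linear_sum L) mulr_suml.
apply: le_trans (Fsum _ _ _) _; apply: ler_sum => j _.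
rewrite [L _](linear_scale _ _ Hlin) fnormZ mulrC.
by rewrite ler_wpM2l ?fnorm_ge0 ?norm_entry_le_fnorm.
Qed.

(** The Rayleigh quotient attains its minimum on the unit sphere of [E], at an
    eigenvector whose eigenvalue is that minimum. *)
Lemma rayleigh_ge (E : set mat) (H : mat -> mat) (eta : R) :
  (forall a A B, E A -> E B -> E (a *: A + B)) ->
  (forall A, (forall eps, 0 < eps -> exists2 B, E B & fnorm (A - B) <= eps) ->
     E A) ->
  linear H -> (forall A, E A -> E (H A)) ->
  (forall A B, E A -> E B -> inner (H A) B = inner (H B) A) ->
  (forall a, eigenvalue_on E H a -> eta <= a) ->
  forall A, E A -> eta * fnorm A ^+ 2 <= inner (H A) A.
Proof.
move=> Elin Ecl Hlin EH Hsym Heig A EA.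
have [C C0 HC] := linear_fnorm_bound Hlin.
have [->|A0] := eqVneq A 0; first by rewrite fnorm0 expr0n /= mulr0 inner0r.
have E0 : E 0 by have := Elin (-1) A A EA EA; rewrite scaleN1r addNr.
have EZ a B : E B -> E (a *: B) by move=> /(Elin a B 0)/(_ E0); rewrite addr0.
have HZ a B : H (a *: B) = a *: H B by exact: linear_scale.
have HD B D : H (B + D) = H B + H D by exact: linear_add.
pose K := [set z : 'rV[R]_(n * r) | E (vec_mx z) /\ fnorm (vec_mx z) = 1].
have vecle (z : 'rV[R]_(n * r)) : `|vec_mx z : mat| <= `|z|.
  rewrite {1}/Num.norm /= mx_normrE; apply: bigmax_le; first exact: normr_ge0.
  move=> [i j] _ /=; rewrite mxE; exact: norm_entry_le_mxnorm.
have N0 : 0 < (n * r).+1%:R :> R by rewrite ltr0n.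
pose M : R := (n * r).+1%:R.
have vecB (z z' : 'rV[R]_(n * r)) :
    fnorm (vec_mx z - vec_mx z' : mat) <= M * `|z - z'|.
  rewrite -linearB (le_trans (fnorm_le_mxnorm _)) //.
  by rewrite ler_wpM2l ?(ltW N0) ?vecle.
have Kcl : closed K.
  rewrite closure_id eqEsubset; split; first exact: subset_closure.
  move=> z zK.
  have near_z (eps : R) : 0 < eps ->
      exists2 z', K z' & fnorm (vec_mx z - vec_mx z' : mat) <= eps.
    move=> e0; have eM : 0 < eps / M by rewrite divr_gt0.
    have [z' [Kz' zz']] := zK _ (nbhsx_ballx z _ eM).
    rewrite mx_norm_ball in zz'.
    exists z' => //; apply: (le_trans (vecB _ _)).
    by rewrite mulrC -ler_pdivlMr //; apply: ltW; exact: zz'.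
  split.
    apply: Ecl => eps /near_z [z' [Kz' _]]; by exists (vec_mx z').
  apply/eqP; rewrite -subr_eq0 -normr_le0; apply/ler_addgt0Pr => eps e0.
  have [z' [_ z'1] zz'] := near_z _ e0; rewrite add0r -z'1.
  exact: le_trans (fnorm_dist _ _) zz'.
have Kbd : bounded_set K.
  exists 1; split; first exact: num_real.
  move=> b b1 z [_ z1]; apply: le_trans (ltW b1).
  rewrite -z1 (le_trans _ (mxnorm_le_fnorm _)) //.
  rewrite {1}/Num.norm /= mx_normrE; apply: bigmax_le; first exact: normr_ge0.
  move=> [i j] _ /=; rewrite ord1; case/mxvec_indexP: j => k l.
  have -> : z 0 (mxvec_index k l) = vec_mx z k l by rewrite mxE.
  exact: norm_entry_le_mxnorm.
pose q (z : 'rV[R]_(n * r)) : R := inner (H (vec_mx z)) (vec_mx z).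
have K0 : K !=set0.
  exists (mxvec ((fnorm A)^-1 *: A)); rewrite /K /= mxvecK; split; first exact: EZ.
  by rewrite fnormZ gtr0_norm ?invr_gt0 ?fnorm_gt0 // mulVf // gt_eqF ?fnorm_gt0.
have qcont : continuous q.
  move=> z; apply/(@cvgrPdist_le _ _ _ (nbhs z) (nbhs_filter z)) => eps e0.
  pose a : mat := vec_mx z; pose k := C * M * (2 * fnorm a + M) + 1.
  have k0 : 0 < k.
    have := fnorm_ge0 a => ?.
    by rewrite /k ltr_wpDl // !mulr_ge0 ?addr_ge0 ?mulr_ge0 ?(ltW N0).
  have close (d : R) : 0 < d -> \forall z' \near z, `|z - z'| <= d.
    move=> d0; apply/nbhs_ballP; exists d => // z'.
    rewrite mx_norm_ball => zz'; apply: ltW; exact: zz'.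
  near=> z'.
  have z1 : `|z - z'| <= 1 by near: z'; exact: close.
  have z2 : `|z - z'| <= eps / k by near: z'; apply: close; rewrite divr_gt0.
  pose b : mat := vec_mx z'.
  have ab : fnorm (b - a) <= M * `|z - z'| by rewrite distrC; exact: vecB.
  rewrite /q -/a -/b.
  have -> : inner (H a) a - inner (H b) b = - (inner (H a) (b - a)
     + inner (H (b - a)) b).
    have HB : H b = H a + H (b - a) by rewrite -HD addrC subrK.
    by rewrite {1}HB innerBr innerDl; lra.
  rewrite normrN (le_trans (ler_normD _ _)) //.
  have h1 := norm_inner_le (H a) (b - a); have h2 := norm_inner_le (H (b - a)) b.
  have h3 := HC a; have h4 := HC (b - a).
  have h5 : fnorm b <= fnorm a + M.
    have := fnorm_split b a 0; rewrite !subr0 => h.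
    have : M * `|z - z'| <= M by rewrite ler_piMr ?(ltW N0).
    lra.
  have a0 := fnorm_ge0 a; have b0 := fnorm_ge0 b.
  have c0 := fnorm_ge0 (b - a).
  have h6 : fnorm (H a) * fnorm (b - a) <= C * fnorm a * (M * `|z - z'|).
    by rewrite ler_pM ?fnorm_ge0.
  have h7 : fnorm (H (b - a)) * fnorm b <=
      C * (M * `|z - z'|) * (fnorm a + M).
    rewrite ler_pM ?fnorm_ge0 //; apply: (le_trans h4).
    by rewrite ler_wpM2l.
  apply: (@le_trans _ _ (k * `|z - z'|)).
    by have := normr_ge0 (z - z'); rewrite /k; lra.
  by rewrite mulrC -ler_pdivlMr.
have [z0] := EVT_min_rV K0 (bounded_closed_compact Kbd Kcl)
  (continuous_subspaceT qcont).
rewrite inE => -[Ez0 z01] zmin.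
set U : mat := vec_mx z0 in Ez0 z01.
pose lam := inner (H U) U.
have lam_min B : E B -> lam * fnorm B ^+ 2 <= inner (H B) B.
  move=> EB; have [->|B0] := eqVneq B 0.
    by rewrite fnorm0 expr0n /= mulr0 inner0r.
  have b0 := fnorm_gt0 B0.
  have := zmin (mxvec ((fnorm B)^-1 *: B)); rewrite inE /K /q /= mxvecK -/U => h.
  have : lam <= inner (H ((fnorm B)^-1 *: B)) ((fnorm B)^-1 *: B).
    apply: h; split; first exact: EZ.
    by rewrite fnormZ gtr0_norm ?invr_gt0 // mulVf // gt_eqF.
  rewrite HZ innerZl innerZr mulrA -expr2 exprVn mulrC.
  by rewrite ler_pdivlMr // exprn_gt0.
have stat W : E W -> inner (H U - lam *: U) W = 0.
  move=> EW; set c := inner _ W; set k := inner (H W) W - lam * fnorm W ^+ 2.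
  have k0 : 0 <= k by rewrite subr_ge0 lam_min.
  have par (t : R) : 0 <= 2 * t * c + t ^+ 2 * k.
    have := lam_min (t *: W + U) (Elin t W U EW Ez0).
    rewrite fnorm_sqr HD HZ !innerDl !innerDr !innerZl !innerZr (Hsym W U) //.
    rewrite -!fnorm_sqr z01 (innerC W U) /k /c innerBl innerZl -/lam; lra.
  apply/eqP; rewrite eq_le; apply/andP; split.
    have := par (- (c / (k + 1))); set t := c / (k + 1).
    have tE : c = t * (k + 1) by rewrite /t divfK // gt_eqF //; lra.
    by rewrite tE; nra.
  have := par (- (c / (k + 1))); set t := c / (k + 1).
  have tE : c = t * (k + 1) by rewrite /t divfK // gt_eqF //; lra.
  by rewrite tE; nra.
have HU : H U = lam *: U.
  apply/eqP; rewrite -subr_eq0; apply/eqP/inner_eq0/stat.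
  by rewrite addrC -scaleNr; apply: Elin => //; exact: EH.
have lamE : eigenvalue_on E H lam.
  exists U; split=> //; apply/eqP => U0.
  by move: z01; rewrite U0 fnorm0 => /esym/eqP; rewrite oner_eq0.
have b2 := sqr_ge0 (fnorm A).
apply: le_trans (lam_min A EA).
by rewrite ler_wpM2r // Heig.
Unshelve. all: by end_near. Qed.

End Rayleigh.

(** * The objective pulled back by the retraction *)

Lemma near_eq_differentiable {R : numFieldType} {V W : normedModType R}
  (h k : V -> W) (x : V) :
  (\forall y \near x, h y = k y) -> differentiable k x -> differentiable h x.
Proof.
move=> hk kd; have hkx : h x = k x := nbhs_singleton hk.
have /diff_locallyP [kc kE] := kd.
have hE : h \o shift x = cst (h x) + 'd k x +o_ 0 id.
  apply/eqaddoP => e e0; have /eqaddoP/(_ e e0) ke := kE.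
  have hk0 : \forall y \near (0 : V), h (y + x) = k (y + x).
    by move: hk; rewrite (near_shift 0 x); apply: filterS => y; rewrite /= subr0.
  near=> y.
  have -> : (h \o shift x - (cst (h x) + 'd k x)) y =
      (k \o shift x - (cst (k x) + 'd k x)) y.
    rewrite /= hkx; congr (_ - _); near: y; exact: hk0.
  by near: y.
apply/diff_locallyP.
by have -> : 'd h x = 'd k x :> (V -> W) by exact: diff_unique.
Unshelve. all: by end_near. Qed.

Section Pullback.
Context {R : realType} {n r : nat}.
Local Notation mat := 'M[R]_(n, r).
Implicit Types (x y e v u w A B : mat).

Lemma C2_twice_diff (f : mat -> R^o) x :
  Ck_on 2 [set: mat] f -> twice_diff f x.
Proof.
move=> [fd f2]; split; first by near=> y; exact: fd.
by move=> v; have [] := f2 v => + _; exact.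
Unshelve. all: by end_near. Qed.

Lemma differentiable_pairl (X0 : mat) x :
  differentiable (fun z : mat => (X0, z)) x.
Proof. by apply: differentiable_pair => //; exact: differentiable_cst. Qed.

Lemma derive_pairl (W : normedModType R) (F : mat * mat -> W) (X0 x v : mat) :
  'D_v (fun z => F (X0, z)) x = 'D_(0, v) F (X0, x).
Proof.
rewrite /derive; set q := fun h => _; set q' := fun h => _.
suff -> : q = q' by [].
apply/funext => h; rewrite /q /q' /= /shift /=.
suff -> : h *: (0, v) + (X0, x) = (X0, h *: v + x) by [].
by apply/pair_equal_spec; split=> //=; rewrite scaler0 add0r.
Qed.

(** Composing a C2 function with a C2 partial map keeps the two derivatives
    that [twice_diff] asks for, by the chain rule
    [D_v (f o G) = <grad f o G, D_v G>] and the product rule. *)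
Lemma twice_diff_comp_partial (f : mat -> R^o) (U : set (mat * mat))
    (F : mat * mat -> mat) (X0 : mat) :
  Ck_on 2 [set: mat] f -> open U -> U (X0, 0) -> Ck_on 2 U F ->
  twice_diff (fun z => f (F (X0, z)) : R^o) 0.
Proof.
move=> [fd f2] Uo U0 [Fd F2].
pose emb z : mat * mat := (X0, z).
have embd z : differentiable emb z by exact: differentiable_pairl.
have Unear : \forall z \near (0 : mat), U (X0, z).
  have embc : {for (0 : mat), continuous emb} by exact: differentiable_continuous.
  by apply: embc; exact: open_nbhs_nbhs.
have Gd z : U (X0, z) -> differentiable (F \o emb) z.
  by move=> Uz; apply: differentiable_comp => //; exact: Fd.
have gd z : U (X0, z) -> differentiable (f \o (F \o emb)) z.
  by move=> Uz; apply: differentiable_comp; [exact: Gd|exact: fd].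
split; first by apply: filterS Unear => z; exact: gd.
move=> v.
have vE : \forall z \near (0 : mat), 'D_v (f \o (F \o emb)) z =
    (\sum_i \sum_j (('D_(delta_mx i j) f \o (F \o emb)) *
       (fun z => ('D_(0, v) F \o emb) z i j))) z.
  apply: filterS Unear => z Uz.
  rewrite deriveE; last exact: gd.
  rewrite diff_comp; [|exact: Gd|exact: fd].
  rewrite [LHS]/= -deriveE; last exact: fd.
  rewrite -[in LHS]deriveE; last exact: Gd.
  rewrite [in LHS](derive_pairl F).
  rewrite derive_inner; last exact: fd.
  rewrite innerE fct_sumE; apply: eq_bigr => i _.
  by rewrite fct_sumE; apply: eq_bigr => j _; rewrite mxE.
apply: near_eq_differentiable vE _.
apply: differentiable_sum => i; apply: differentiable_sum => j.
apply: differentiableM.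
  by apply: differentiable_comp; [exact: Gd|have [] := f2 (delta_mx i j) => + _; exact].
apply: (@differentiable_comp _ _ _ _ ('D_(0, v) F \o emb) (fun M : mat => M i j)).
  apply: differentiable_comp => //; have [+ _] := F2 (0, v); exact.
exact: differentiable_coord.
Qed.

(** A directional derivative only depends on the values along a line: this is
    what allows replacing the retraction, which is meaningful on the tangent space
    only, by its smooth local extension. *)
Lemma derive_eq_line (W : normedModType R) (g h : mat -> W) x v :
  (exists2 d : R, 0 < d & forall t : R, `|t| < d ->
     g (x + t *: v) = h (x + t *: v)) ->
  'D_v g x = 'D_v h x.
Proof.
move=> [d d0 gh].
have E (k : mat -> W) : 'D_v k x = 'D_1 (fun s : R => k (x + s *: v)) 0.
  by rewrite line_derive scale0r addr0.
rewrite !E; apply: near_eq_derive; apply/nbhs_ballP; exists d => //= t.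
by rewrite /ball /= sub0r normrN => /gh.
Qed.

(** The tangent space is the fixed space of a bounded projection, hence
    closed. *)
Lemma tangent_approx X0 A : stiefel X0 ->
  (forall eps : R, 0 < eps -> exists2 B, tangent X0 B & fnorm (A - B) <= eps) ->
  tangent X0 A.
Proof.
move=> sX0 HA.
have plin : linear (tproj X0) by move=> a u w; rewrite tprojD tprojZ.
have [C C0 HC] := linear_fnorm_bound plin.
suff -> : A = tproj X0 A by exact: tproj_tangent.
apply/eqP; rewrite -subr_eq0; apply/eqP/fnorm_eq0/eqP.
rewrite eq_le fnorm_ge0 andbT; apply/ler_addgt0Pr => eps e0; rewrite add0r.
have C1 : 0 < 1 + C by lra.
have [B TB AB] := HA _ (divr_gt0 e0 C1).
have -> : A - tproj X0 A = (A - B) - tproj X0 (A - B).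
  by rewrite tprojB (tproj_id TB) [in RHS]opprB subrKA.
apply: (le_trans (fnormBD _ _)); have := HC (A - B).
by move: AB; rewrite ler_pdivlMr //; lra.
Qed.

(** Second-order lower bound for [f] along the retraction: the pullback agrees
    on the tangent space with a C2 function, whose projected Hessian is a
    symmetric operator with eigenvalues at least [eta]. *)
Lemma pullback_lower_bound (f : mat -> R^o) (Rt : mat -> mat -> mat) X0 eta :
  Ck_on 2 [set: mat] f -> retraction Rt -> stiefel X0 ->
  (eta%:E <= lambda_min (tangent X0)
     (hess_on (tangent X0) (fun xi => f (Rt X0 xi)) 0))%E ->
  forall eps : R, 0 < eps -> exists2 d, 0 < d &
    forall z, tangent X0 z -> fnorm z <= d ->
      f X0 + inner (grad f X0) z + (eta / 2 - eps) * fnorm z ^+ 2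
      <= f (Rt X0 z).
Proof.
move=> fC2 [_ Rsm R0 Rd] sX0 hess_lb eps eps0.
set E := tangent X0 in hess_lb *.
set g := (fun xi => f (Rt X0 xi)) in hess_lb.
have ET0 : E 0 := tangent0 X0.
have [U [F [Uo U0 FC URt]]] := Rsm (X0, 0) (conj sX0 ET0).
pose G z := F (X0, z); pose gt z : R^o := f (G z).
have td : twice_diff gt 0 by apply: (twice_diff_comp_partial fC2 Uo U0); exact: FC.
have [dU dU0 UP] : exists2 d, 0 < d & forall z : mat, fnorm (z - 0) <= d -> U (X0, z).
  apply/nbhs_fnormP.
  have embc : {for (0 : mat), continuous (fun z : mat => (X0, z))}.
    exact/differentiable_continuous/differentiable_pairl.
  by apply: embc; exact: open_nbhs_nbhs.
have RtG z : E z -> fnorm z <= dU -> Rt X0 z = G z.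
  by move=> Ez zd; apply: (URt (X0, z)) => //; apply: UP; rewrite subr0.
have G0 : G 0 = X0 by rewrite -RtG ?fnorm0 ?(ltW dU0) // R0.
have [dD dD0 gtd] := twice_diff_ball td.
have line_small (z V : mat) : fnorm z < dU -> exists2 d : R, 0 < d & forall t : R,
    `|t| < d -> fnorm (z + t *: V) <= dU.
  move=> zd; have V1 : 0 < fnorm V + 1 by have := fnorm_ge0 V; lra.
  have dz : 0 < dU - fnorm z by lra.
  exists ((dU - fnorm z) / (fnorm V + 1)); first by rewrite divr_gt0.
  move=> t; rewrite ltr_pdivlMr // => ht.
  apply: (le_trans (fnormD _ _)); rewrite fnormZ.
  by have := normr_ge0 t; have := fnorm_ge0 V; nra.
have gline z V : E z -> E V -> fnorm z < dU -> 'D_V (g : mat -> R^o) z = 'D_V gt z.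
  move=> Ez EV zd; apply: (@derive_eq_line _ (g : mat -> R^o) gt).
  have [d d0 H] := line_small z V zd; exists d => // t td'.
  by rewrite /g /gt RtG ?H //; apply: tangentD => //; exact: tangentZ.
have Gd : differentiable G 0.
  apply: differentiable_comp; first exact: differentiable_pairl.
  by have [+ _] := FC 2%N; exact.
have DG V : E V -> 'D_V G 0 = V.
  move=> EV; have [_ RV] := Rd X0 V sX0 EV.
  transitivity ('D_V (Rt X0 : mat -> mat) 0); last exact: RV.
  apply: (@derive_eq_line _ G (Rt X0)); have dd : fnorm (0 : mat) < dU by rewrite fnorm0.
  have [d d0 H] := line_small 0 V dd; exists d => // t td'.
  rewrite RtG ?H //.
  by apply: tangentD => //; exact: tangentZ.
have fd y : differentiable f y by have [+ _] := fC2; exact.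
have grad0 V : E V -> inner (grad gt 0) V = inner (grad f X0) V.
  move=> EV; rewrite -derive_grad; last by apply: gtd; rewrite subr0 fnorm0 ltW.
  rewrite deriveE; last by apply: gtd; rewrite subr0 fnorm0 ltW.
  rewrite (diff_comp Gd (fd _)) [LHS]/= -(deriveE _ Gd) DG //.
  by rewrite -(deriveE _ (fd _)) (derive_grad _ (fd _)) G0.
have data := twice_diff_data td.
have [_ Hlin Hexp] := data.
have Hsym u w := hessian_sym u w data.
move: Hlin Hexp Hsym data grad0; set gG := grad gt; set H := hessian gt 0.
move=> Hlin Hexp Hsym data grad0.
have gradE z : E z -> fnorm z <= Num.min dD (dU / 2) ->
    grad_on E g z = tproj X0 (gG z).
  move=> Ez; rewrite le_min => /andP[zD zU]; apply: grad_on_eq.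
  - exact: tangentB.
  - exact: tproj_tangent.
  - move=> V EV; rewrite inner_tproj // gline //; last by lra.
    by rewrite derive_grad //; apply: gtd; rewrite subr0.
have plin : linear (tproj X0) by move=> a u w; rewrite tprojD tprojZ.
have [C C0 HC] := linear_fnorm_bound plin.
have hessE V : E V -> hess_on E g 0 V = tproj X0 (H V).
  move=> EV; rewrite /hess_on.
  transitivity ('D_V (fun z => tproj X0 (gG z)) 0).
    apply: (@derive_eq_line _ (grad_on E g) (fun z => tproj X0 (gG z))).
    have V1 : 0 < fnorm V + 1 by have := fnorm_ge0 V; lra.
    have m0 : 0 < Num.min dD (dU / 2) by rewrite lt_min dD0 divr_gt0.
    exists (Num.min dD (dU / 2) / (fnorm V + 1)); first by rewrite divr_gt0.
    move=> t; rewrite ltr_pdivlMr // => ht; rewrite add0r; apply: gradE.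
      exact: tangentZ.
    by rewrite fnormZ; have := normr_ge0 t; have := fnorm_ge0 V; nra.
  apply/cvg_lim; first exact: norm_hausdorff.
  apply/cvgrPdist_le => e e0.
  have V1 : 0 < C * fnorm V + 1 by rewrite ltr_wpDl // mulr_ge0 ?fnorm_ge0.
  have [d d0 He] := Hexp _ (divr_gt0 e0 V1).
  have W1 : 0 < fnorm V + 1 by have := fnorm_ge0 V; lra.
  near=> t.
  have t0 : t != 0 by near: t; exact: nbhs_dnbhs_neq.
  have td' : `|t| < d / (fnorm V + 1).
    by near: t; apply: dnbhs0_lt; rewrite divr_gt0.
  rewrite /= /shift /= addr0 -tprojB -tprojZ -tprojB.
  apply: (le_trans (mxnorm_le_fnorm _)); apply: (le_trans (HC _)).
  have ht : fnorm (t *: V) <= d.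
    move: td'; rewrite ltr_pdivlMr // fnormZ => ?.
    by have := normr_ge0 t; lra.
  have := He _ ht; rewrite add0r (linear_scale _ _ Hlin) => K.
  have -> : H V - t^-1 *: (gG (t *: V) - gG 0) =
      - t^-1 *: (gG (t *: V) - gG 0 - t *: H V).
    by rewrite scaleNr [in RHS]scalerBr scalerA mulVf // scale1r opprB.
  rewrite fnormZ normrN normfV.
  have tp : 0 < `|t| by rewrite normr_gt0.
  rewrite mulrCA ler_pdivrMl //.
  apply: (@le_trans _ _ (C * (e / (C * fnorm V + 1) * (`|t| * fnorm V)))).
    by rewrite ler_wpM2l // -fnormZ.
  rewrite [leLHS](_ : _ = `|t| * (e * (C * fnorm V / (C * fnorm V + 1)))).
    rewrite ler_wpM2l ?(ltW tp) // ler_piMr ?(ltW e0) // ler_pdivrMr //; lra.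
  by field; rewrite gt_eqF.
pose H' := fun V => tproj X0 (H V).
have H'lin : linear H' by move=> a u w; rewrite /H' Hlin plin.
have ray : forall A, E A -> eta * fnorm A ^+ 2 <= inner (H' A) A.
  apply: rayleigh_ge => //.
  - by move=> a A B EA EB; apply: tangentD => //; exact: tangentZ.
  - by move=> A; exact: tangent_approx.
  - by move=> A EA; exact: tproj_tangent.
  - by move=> A B EA EB; rewrite /H' !inner_tproj.
  - move=> a [V [EV V0 HV]]; rewrite -lee_fin; apply: (le_trans hess_lb).
    apply: ereal_inf_lbound; exists a => //; exists V; split=> //.
    by rewrite hessE.
have [d d0 T] := taylor2 data eps0.
exists (Num.min d dU) => [|z Ez]; first by rewrite lt_min d0.
rewrite le_min => /andP[zd zU].
have := T z zd; rewrite add0r grad0 // -[gt 0]/(f (G 0)) G0.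
rewrite -[gt z]/(f (G z)) -RtG // ler_norml => /andP[lo _].
have := ray z Ez; rewrite /H' inner_tproj //; move: lo.
move: (inner _ _) (inner _ _) (f _) (f _) (fnorm z ^+ 2) => a b c e k; lra.
Unshelve. all: by end_near. Qed.

End Pullback.

(** * Local geometry at the accumulation point *)

Section Chord.
Context {R : realType} {n r : nat}.
Local Notation mat := 'M[R]_(n, r).
Implicit Types (X Y A D Z T W S : mat).

Lemma fnorm_tproj_le X A : stiefel X -> fnorm (tproj X A) <= fnorm A.
Proof.
move=> sX; have [p0|p0] := eqVneq (tproj X A) 0.
  by rewrite p0 fnorm0 fnorm_ge0.
have := inner_le_fnorm A (tproj X A).
rewrite -(inner_tproj A (tproj_tangent A sX)) -fnorm_sqr expr2.
by rewrite ler_pM2r ?fnorm_gt0.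
Qed.

Lemma fnorm_gram_le A : fnorm (A^T *m A) <= fnorm A ^+ 2.
Proof. by rewrite (le_trans (fnorm_mulmx _ _)) // fnorm_trmx expr2. Qed.

Lemma fnorm_gramB A D :
  fnorm (A^T *m A - D^T *m D) <= fnorm (A - D) * (fnorm A + fnorm D).
Proof.
have -> : A^T *m A - D^T *m D = A^T *m (A - D) + (A - D)^T *m D.
  by rewrite mulmxBr linearB /= mulmxBl addrA subrK.
apply: (le_trans (fnormD _ _)).
have := fnorm_mulmx A^T (A - D); have := fnorm_mulmx (A - D)^T D.
by rewrite !fnorm_trmx; lra.
Qed.

(** A nearby point [X] of the manifold seen from [X0] through the retraction:
    up to third order, [X] is [Rt X0 Z - T] where the tangent vector [T] is the
    tangential part of the second-order term of the retraction.  Normal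
    components need no care, since on the manifold they are determined to third
    order by the Gram matrix of the chord.  The vector [W] plays the part of the
    inverse retraction at [X] applied to [X0]. *)
Lemma chord_model (Rt : mat -> mat -> mat) (M2 : R) X0 X :
  0 < M2 -> stiefel X0 -> stiefel X ->
  (forall xi, tangent X0 xi -> stiefel (Rt X0 xi)) ->
  (forall xi, tangent X0 xi ->
     fnorm (Rt X0 xi - X0 - xi) <= M2 * fnorm xi ^+ 2) ->
  let a := fnorm (X - X0) in let c := (M2 + 1) * (M2 + 2) in
  a <= 1 ->
  exists Z T W,
   [/\ tangent X0 Z, tangent X0 T & tangent X W] /\
   [/\ a ^+ 2 - a ^+ 3 <= fnorm Z ^+ 2, fnorm Z <= a &
       fnorm (X - Rt X0 Z + T) <= c * a ^+ 3] /\
   [/\ fnorm T <= M2 * a ^+ 2,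
       fnorm (X - X0 - (Z - T)) <= M2 * a ^+ 2 + c * a ^+ 3,
       fnorm (W + (X - X0) + (X - X0 - (Z - T))) <= c * a ^+ 3 &
       fnorm W <= (1 + M2) * a].
Proof.
move=> M20 sX0 sX Rst RM2 a c a1.
have a0 : 0 <= a := fnorm_ge0 _.
pose D := X - X0.
pose Z := tproj X0 D; have TZ : tangent X0 Z by exact: tproj_tangent.
pose Y := Rt X0 Z; have sY : stiefel Y by exact: Rst.
pose e := Y - X0; pose T := tproj X0 e - Z.
have Za : fnorm Z <= a by exact: fnorm_tproj_le.
have z0 := fnorm_ge0 Z.
have eZ : fnorm (e - Z) <= M2 * a ^+ 2.
  apply: (le_trans (RM2 _ TZ)); rewrite ler_wpM2l ?(ltW M20) //.
  by rewrite ler_pXn2r ?nnegrE.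
have TE : T = tproj X0 (e - Z) by rewrite tprojB (tproj_id TZ).
have TT : tangent X0 T by rewrite TE; exact: tproj_tangent.
have Ta : fnorm T <= M2 * a ^+ 2.
  by rewrite TE (le_trans (fnorm_tproj_le _ sX0)).
have ZE : Z = D + 2^-1 *: (X0 *m (D^T *m D)) by exact: tproj_chord.
have ZTE : Z + T = e + 2^-1 *: (X0 *m (e^T *m e)).
  by rewrite /T addrC subrK; exact: tproj_chord.
have half (A : 'M[R]_r) (Q : mat) : stiefel Q ->
    fnorm (2^-1 *: (Q *m A)) = 2^-1 * fnorm A.
  by move=> sQ; rewrite fnormZ fnorm_stiefel_mul // ger0_norm // invr_ge0.
have gram : fnorm (D^T *m D) <= a ^+ 2 by exact: fnorm_gram_le.
have ZD : fnorm (Z - D) <= 2^-1 * a ^+ 2.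
  by rewrite ZE addrAC subrr add0r half // ler_wpM2l ?invr_ge0.
have eD : fnorm (e - D) <= (M2 + 2^-1) * a ^+ 2.
  by have := fnorm_split e Z D; lra.
have en : fnorm e <= (1 + M2) * a.
  have := fnorm_split e Z 0; rewrite !subr0 => h.
  have : a ^+ 2 <= a by rewrite expr2 ler_piMr.
  by nra.
have DE : fnorm D = a by [].
have gramB : fnorm (e^T *m e - D^T *m D) <= 2 * c * a ^+ 3.
  apply: (le_trans (fnorm_gramB _ _)); rewrite DE.
  apply: (@le_trans _ _ ((M2 + 2^-1) * a ^+ 2 * ((2 + M2) * a))).
    by rewrite ler_pM ?fnorm_ge0 ?addr_ge0 ?fnorm_ge0 //; lra.
  rewrite /c; have a3 : 0 <= a ^+ 3 by exact: exprn_ge0.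
  have : 0 <= M2 * a ^+ 3 by rewrite mulr_ge0 ?(ltW M20).
  have : 0 <= M2 ^+ 2 * a ^+ 3 by rewrite mulr_ge0 ?sqr_ge0.
  by lra.
have XYT : X - Y + T = 2^-1 *: (X0 *m (e^T *m e - D^T *m D)).
  have -> : T = e + 2^-1 *: (X0 *m (e^T *m e)) - Z by rewrite -ZTE addrC addKr.
  rewrite ZE (mulmxBr X0 (e^T *m e)) scalerBr.
  move: (2^-1 *: (X0 *m (e^T *m e))) (2^-1 *: (X0 *m (D^T *m D))) => P Q.
  rewrite /e /D; apply/matrixP => i j; rewrite !mxE; ring.
have SE : X - X0 - (Z - T) = (e - Z) + 2^-1 *: (X0 *m (e^T *m e - D^T *m D)).
  rewrite -XYT /e.
  by move: (T) (Z) (Y) => t z y; apply/matrixP => i j; rewrite !mxE; ring.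
pose W := tproj X (- D - T).
have WE : W + (X - X0) + (X - X0 - (Z - T)) =
    2^-1 *: (D *m (D^T *m D)) - (tproj X T - T).
  have chord := tproj_chord sX sX0.
  have gE : (X0 - X)^T *m (X0 - X) = D^T *m D.
    have -> : X0 - X = - D by rewrite opprB.
    by rewrite [(- D)^T]linearN /= mulNmx mulmxN opprK.
  rewrite gE in chord.
  have -> : W = - D + 2^-1 *: (X *m (D^T *m D)) - tproj X T.
    by rewrite /W tprojB {1}/D opprB chord /D opprB.
  rewrite ZE [D *m _](mulmxBl X X0) scalerBr.
  move: (2^-1 *: (X *m _)) (2^-1 *: (X0 *m _)) (tproj X T) (T) => P Q p t.
  rewrite /D.
  by apply/matrixP => i j; rewrite !mxE; ring.
exists Z, T, W; split; [split|split; split] => //.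
- exact: tproj_tangent.
- have h := fnorm_split D Z 0; rewrite !subr0 in h.
  have h2 : a - 2^-1 * a ^+ 2 <= fnorm Z by rewrite fnormB in ZD; lra.
  have h3 : 0 <= a - 2^-1 * a ^+ 2 by nra.
  apply: (@le_trans _ _ ((a - 2^-1 * a ^+ 2) ^+ 2)).
    have : 0 <= a ^+ 2 * a ^+ 2 by rewrite mulr_ge0 ?sqr_ge0.
    by rewrite !exprS expr0; lra.
  by rewrite ler_pXn2r ?nnegrE.
- by rewrite XYT half //; lra.
- by rewrite SE (le_trans (fnormD _ _)) // half //; lra.
- rewrite WE (le_trans (fnormBD _ _)) // fnormZ ger0_norm ?invr_ge0 //.
  have := fnorm_mulmx D (D^T *m D); have := tproj_transport sX TT.
  rewrite -/D DE => h1 h2.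
  have h3 : a * fnorm T <= M2 * a ^+ 3.
    by rewrite [leRHS](_ : _ = a * (M2 * a ^+ 2)) ?ler_wpM2l //; ring.
  have h4 : a * fnorm (D^T *m D) <= a ^+ 3.
    by rewrite exprS ler_wpM2l.
  have a3 : 0 <= a ^+ 3 by exact: exprn_ge0.
  have : 0 <= M2 * a ^+ 3 by rewrite mulr_ge0 ?(ltW M20).
  have : 0 <= M2 ^+ 2 * a ^+ 3 by rewrite mulr_ge0 ?sqr_ge0.
  by rewrite /c; lra.
- apply: (le_trans (fnorm_tproj_le _ sX)); apply: (le_trans (fnormBD _ _)).
  rewrite fnormN DE; have : a ^+ 2 <= a by rewrite expr2 ler_piMr.
  by nra.
Qed.

End Chord.

Section LocalModel.
Context {R : realType} {n r : nat}.
Local Notation mat := 'M[R]_(n, r).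
Implicit Types (X Y A D Z T W S : mat).
Context (f : mat -> R^o) (G H : mat -> mat) (L : R).
Hypothesis L0 : 0 <= L.
Hypothesis fG : forall Y,
  differentiable f Y /\ forall V, 'D_V f Y = inner (G Y) V.
Hypothesis GL : forall X Y, fnorm (G X - G Y) <= L * fnorm (X - Y).

Lemma smooth_bound X Y :
  `|f Y - f X - inner (G X) (Y - X)| <= L * fnorm (Y - X) ^+ 2.
Proof.
have [c c01] := mvt_segment (fun t (_ : t \in `[0, 1]) => fG (X + t *: (Y - X))).
rewrite [X + (Y - X)]addrC subrK => ->; rewrite -innerBl.
apply: (le_trans (norm_inner_le _ _)); rewrite expr2 mulrA.
rewrite ler_wpM2r ?fnorm_ge0 //; apply: (le_trans (GL _ _)).
rewrite addrC addKr ler_wpM2l // fnormZ.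
move: c01; rewrite in_itv /= => /andP[c0 c1].
by rewrite ger0_norm // ler_piMl ?fnorm_ge0.
Qed.

Lemma cube_small (C eps a : R) : 0 <= C -> 0 < eps -> 0 <= a ->
  a <= eps / (C + 1) -> C * a ^+ 3 <= eps * a ^+ 2.
Proof.
move=> C0 e0 a0; rewrite ler_pdivlMr ?ltr_wpDl // => ha.
by rewrite exprS mulrA ler_wpM2r ?sqr_ge0 //; nra.
Qed.

Context (X0 : mat).
Hypothesis dataf : second_order_data f X0 G H.

(** Up to [o(|d| ^ 2)] with [d = X - X0], the linearisation of [f] at [X] falls
    short of [f X0] by [<H d, d> / 2], and the one at [X0] falls short of [f X] by
    the same amount; comparing the two removes the second derivative. *)
Lemma tangent_plane_swap (eps : R) : 0 < eps ->
  exists2 d, 0 < d & forall X, fnorm (X - X0) <= d ->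
    f X + inner (G X) (X0 - X) <=
    2 * f X0 + inner (G X0) (X - X0) - f X + eps * fnorm (X - X0) ^+ 2.
Proof.
move=> e0; have e30 : 0 < eps / 3 by rewrite divr_gt0.
have [d1 d10 T] := taylor2 dataf e30.
have [_ _ /(_ _ e30) [d2 d20 E]] := dataf.
exists (Num.min d1 d2) => [|X]; rewrite ?lt_min ?d10 // le_min => /andP[X1 X2].
have := T _ X1; have := E _ X2; rewrite ![X0 + (X - X0)]addrC !subrK.
set D := X - X0; move=> HE.
have : `|inner (G X - G X0 - H D) D| <= eps / 3 * fnorm D ^+ 2.
  apply: (le_trans (norm_inner_le _ _)); rewrite expr2 mulrA.
  by rewrite ler_wpM2r ?fnorm_ge0.
have -> : X0 - X = - D by rewrite opprB.
rewrite innerNr !innerBl !ler_norml => /andP[? ?] /andP[? ?].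
by lra.
Qed.

Context (Rt : mat -> mat -> mat) (M2 eta : R).
Hypotheses (M20 : 0 < M2) (sX0 : stiefel X0) (eta0 : 0 <= eta).
Hypothesis Rst : forall xi, tangent X0 xi -> stiefel (Rt X0 xi).
Hypothesis RM2 : forall xi, tangent X0 xi ->
  fnorm (Rt X0 xi - X0 - xi) <= M2 * fnorm xi ^+ 2.
Hypothesis pullback : forall eps : R, 0 < eps -> exists2 d, 0 < d &
  forall z, tangent X0 z -> fnorm z <= d ->
    f X0 + inner (G X0) z + (eta / 2 - eps) * fnorm z ^+ 2 <= f (Rt X0 z).

(** The third-order errors of [chord_model] are absorbed into [eps], and the lower
    bound for [f] is moved from the retracted point [Rt X0 Z] to [X], which
    differs from it by the second-order tangent vector [- T]. *)
Lemma local_model (eps : R) : 0 < eps ->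
  exists2 d, 0 < d & forall X, stiefel X -> fnorm (X - X0) <= d ->
  let a := fnorm (X - X0) in
  exists zeta W, let S := X - X0 - zeta in
  [/\ tangent X0 zeta, tangent X W & fnorm W <= (1 + M2) * a] /\
  [/\ fnorm S <= (M2 + eps) * a ^+ 2,
      fnorm (W + (X - X0) + S) <= eps * a ^+ 2 &
      f X0 + inner (G X0) zeta + (eta / 2 - eps) * a ^+ 2 <= f X].
Proof.
have M2p := M20; have Lp := L0; have etap := eta0.
move=> e0; have e20 : 0 < eps / 2 by rewrite divr_gt0.
have [d1 d10 PB] := pullback e20.
pose c := (M2 + 1) * (M2 + 2).
have c0 : 0 <= c by rewrite mulr_ge0 //; lra.
pose k := M2 + c.
have g0 := fnorm_ge0 (G X0).
pose C := fnorm (G X0) * c + L * (1 + M2) * k + L * k ^+ 2 + eta / 2.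
have k0 : 0 <= k by rewrite addr_ge0 // ltW.
have C0 : 0 <= C by rewrite !addr_ge0 // !mulr_ge0 ?sqr_ge0 //; lra.
pose d := Num.min (Num.min 1 d1) (Num.min (eps / (c + 1)) ((eps / 2) / (C + 1))).
exists d; first by rewrite !lt_min ltr01 d10 !divr_gt0 //; lra.
move=> X sX; rewrite !le_min => /andP[/andP[a1 ad1] /andP[ac aC]] a.
have a0 : 0 <= a := fnorm_ge0 _.
have [Z [T [W]]] := chord_model M20 sX0 sX Rst RM2 a1.
rewrite -/a -/c => -[[TZ TT TW] [[Zlo Zhi XY] [Tn Sn Wn Wn']]].
have a3 : 0 <= a ^+ 3 by rewrite exprn_ge0.
have ca := cube_small c0 e0 a0 ac; have Ca := cube_small C0 e20 a0 aC.
exists (Z - T), W; split; first by split=> //; exact: tangentB.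
split; [lra|lra|].
set Y := Rt X0 Z in XY.
have a32 : a ^+ 3 <= a ^+ 2 by rewrite exprS ler_piMl ?sqr_ge0.
have a43 : a ^+ 4 <= a ^+ 3 by rewrite exprS ler_piMl.
have z0 := fnorm_ge0 Z.
have Z2 : fnorm Z ^+ 2 <= a ^+ 2 by rewrite ler_pXn2r ?nnegrE.
have XYn : fnorm (X - Y) <= k * a ^+ 2.
  have h := fnormBD (X - Y + T) T; rewrite addrK in h.
  have : c * a ^+ 3 <= c * a ^+ 2 by rewrite ler_wpM2l.
  by rewrite /k; lra.
have YX0 : fnorm (Y - X0) <= (1 + M2) * a.
  have h := fnormD (Y - X0 - Z) Z; rewrite subrK in h.
  have h1 := RM2 TZ; rewrite -/Y in h1.
  have h2 : M2 * fnorm Z ^+ 2 <= M2 * a ^+ 2 by rewrite ler_wpM2l ?(ltW M20).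
  have h3 : M2 * a ^+ 2 <= M2 * a.
    by rewrite ler_wpM2l ?(ltW M20) // expr2 ler_piMr.
  lra.
have sb := smooth_bound Y X; rewrite ler_norml in sb.
have {sb} /andP[sb _] := sb.
have e1 : inner (G Y) (X - Y) = - inner (G X0) T + inner (G X0) (X - Y + T)
    + inner (G Y - G X0) (X - Y).
  by rewrite innerBl innerDr; lra.
have e2 : - (fnorm (G X0) * c * a ^+ 3) <= inner (G X0) (X - Y + T).
  rewrite lerNl -innerNr (le_trans (inner_le_fnorm _ _)) // fnormN -mulrA.
  by rewrite ler_wpM2l.
have e3 : - (L * (1 + M2) * k * a ^+ 3) <= inner (G Y - G X0) (X - Y).
  rewrite lerNl -innerNr (le_trans (inner_le_fnorm _ _)) // fnormN.
  apply: (@le_trans _ _ ((L * ((1 + M2) * a)) * (k * a ^+ 2))).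
    rewrite ler_pM ?fnorm_ge0 // (le_trans (GL _ _)) //.
    by rewrite ler_wpM2l.
  by rewrite le_eqVlt; apply/orP; left; apply/eqP; ring.
have e4 : L * fnorm (X - Y) ^+ 2 <= L * k ^+ 2 * a ^+ 3.
  rewrite -mulrA ler_wpM2l //.
  apply: (@le_trans _ _ ((k * a ^+ 2) ^+ 2)).
    by rewrite ler_pXn2r ?nnegrE ?fnorm_ge0 // mulr_ge0 ?sqr_ge0.
  by rewrite exprMn -exprM ler_wpM2l ?sqr_ge0.
have := PB _ TZ (le_trans Zhi ad1); rewrite -/Y => pb.
have e5 : eta / 2 * (a ^+ 2 - a ^+ 3) <= eta / 2 * fnorm Z ^+ 2.
  by rewrite ler_wpM2l // divr_ge0.
have e6 : eps / 2 * fnorm Z ^+ 2 <= eps / 2 * a ^+ 2.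
  by rewrite ler_wpM2l // ltW.
rewrite innerBr; move: Ca; rewrite /C => Ca; lra.
Qed.

Context (h : mat -> R) (Lh : R).
Hypotheses (Lh0 : 0 <= Lh) (hL : frob_lipschitz Lh h).

Lemma lipschitz_le X Y : h X <= h Y + Lh * fnorm (X - Y).
Proof. by have := hL X Y; rewrite ler_norml => /andP[_]; lra. Qed.

(** Stationarity makes the first-order terms cancel; the curvature [eta] of the
    smooth part then beats the second-order error [Lh * M2] of the nonsmooth
    part. *)
Lemma quadratic_growth (eps : R) :
  (forall W, tangent X0 W -> 0 <= inner (G X0) W + h (X0 + W) - h X0) ->
  0 < eps ->
  exists2 d, 0 < d & forall X, stiefel X -> fnorm (X - X0) <= d ->
    (eta / 2 - Lh * M2 - eps) * fnorm (X - X0) ^+ 2 <=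
    f X + h X - (f X0 + h X0).
Proof.
have M2p := M20; have Lp := L0; have Lhp := Lh0.
move=> stat e0; have L1 : 0 < 1 + Lh by lra.
have [d d0 LM] := local_model (divr_gt0 e0 L1).
exists d => // X sX ad; have [zeta [W [[Tz _ _] [Sn _ fX]]]] := LM X sX ad.
move: Sn fX; set a := fnorm (X - X0); set S := X - X0 - zeta => Sn fX.
have hX := lipschitz_le (X0 + zeta) X.
have SE : fnorm (X0 + zeta - X) = fnorm S by rewrite fnormB opprD addrA.
rewrite SE in hX; have := stat _ Tz.
have LS : Lh * fnorm S <= Lh * ((M2 + eps / (1 + Lh)) * a ^+ 2).
  by rewrite ler_wpM2l.
have eE : eps = eps / (1 + Lh) * (1 + Lh) by rewrite divfK // gt_eqF.
rewrite [X in _ - _ - X]eE; move: (eps / _) (a ^+ 2) LS fX => e b LS fX.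
by move: (inner _ _) fX => c fX; lra.
Qed.

(** [tangent_plane_swap] trades the linearisation at [X] for [- f X], so that the
    lower bound of [local_model] becomes an upper bound.  The first-order terms
    cancel because [W + (X - X0)] is [- S] to third order, and [h] pays
    [Lh * |S|]. *)
Lemma model_decrease (eps : R) : 0 < eps ->
  exists2 d, 0 < d & forall X, stiefel X -> fnorm (X - X0) <= d ->
    exists W, [/\ tangent X W, fnorm W <= (1 + M2) * fnorm (X - X0) &
      f X + inner (G X) W + h (X + W) <=
      f X0 + h X0 - (eta / 2 - Lh * M2 - eps) * fnorm (X - X0) ^+ 2].
Proof.
have M2p := M20; have Lp := L0; have Lhp := Lh0.
move=> e0; have g0 := fnorm_ge0 (G X0).
pose q := 4 + 2 * Lh + fnorm (G X0) + L.
have q0 : 0 < q by rewrite /q; lra.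
pose e := eps / q; have ee0 : 0 < e by rewrite divr_gt0.
have eE : eps = e * q by rewrite /e divfK // gt_eqF.
clearbody e; have [d1 d10 LM] := local_model ee0.
have [d2 d20 TP] := tangent_plane_swap ee0.
pose C := L * (M2 + e); have C0 : 0 <= C by rewrite mulr_ge0 //; lra.
pose d := Num.min (Num.min 1 d1) (Num.min d2 (e / (C + 1))).
exists d; first by rewrite !lt_min ltr01 d10 d20 !divr_gt0 //; lra.
move=> X sX; rewrite !le_min => /andP[/andP[a1 ad1] /andP[ad2 aC]].
have [zeta [W [[Tz TW Wn] [Sn WS fX]]]] := LM X sX ad1.
have tp := TP X ad2; exists W; split=> //.
have a0 := fnorm_ge0 (X - X0).
have Ca := cube_small C0 ee0 a0 aC.
move: Wn Sn WS fX tp a0 a1 Ca; set a := fnorm (X - X0).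
set S := X - X0 - zeta => Wn Sn WS fX tp a0 a1 Ca.
pose E := W + (X - X0) + S; rewrite -/E in WS.
have WE : W = E + (X0 - X) - S.
  by rewrite /E; move: (S) => s; apply/matrixP => i j; rewrite !mxE; ring.
have hX := lipschitz_le (X + W) X0.
have hW : fnorm (X + W - X0) <= (M2 + e + e) * a ^+ 2.
  have -> : X + W - X0 = E - S.
    by rewrite WE; move: (E) (S) => s t; apply/matrixP => i j; rewrite !mxE; ring.
  by rewrite (le_trans (fnormBD _ _)) //; lra.
have LW : Lh * fnorm (X + W - X0) <= Lh * ((M2 + e + e) * a ^+ 2).
  by rewrite ler_wpM2l.
have GX : fnorm (G X - G X0) <= L * a := GL X X0.
have GXn : fnorm (G X) <= fnorm (G X0) + L.
  have h1 := fnormD (G X - G X0) (G X0); rewrite subrK in h1.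
  have : L * a <= L by rewrite ler_piMr.
  lra.
have b1 : inner (G X) E <= (fnorm (G X0) + L) * (e * a ^+ 2).
  by rewrite (le_trans (inner_le_fnorm _ _)) // ler_pM ?fnorm_ge0.
have b2 : - inner (G X - G X0) S <= C * a ^+ 3.
  rewrite -innerNr (le_trans (inner_le_fnorm _ _)) // fnormN.
  rewrite [leRHS](_ : _ = L * a * ((M2 + e) * a ^+ 2)).
    by rewrite ler_pM ?fnorm_ge0.
  by rewrite /C; ring.
have -> : inner (G X) W = inner (G X) E + inner (G X) (X0 - X)
    - inner (G X - G X0) S - inner (G X0) S.
  by rewrite {1}WE innerBr innerDr innerBl; ring.
have zE : inner (G X0) (X - X0) = inner (G X0) zeta + inner (G X0) S.
  by rewrite -innerDr [zeta + _]addrC /S subrK.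
have ea : 0 <= e * a ^+ 2 by rewrite mulr_ge0 ?sqr_ge0 ?(ltW ee0).
rewrite eE /q; rewrite zE in tp.
move: (inner (G X) E) (inner (G X) (X0 - X)) (inner (G X - G X0) S)
  (inner (G X0) S) (inner (G X0) zeta) b1 b2 tp fX => i1 i2 i3 i4 i5 b1 b2 tp fX.
lra.
Qed.

End LocalModel.

(** * Nonmonotone real sequences *)

Section Window.
Context {R : realType}.
Implicit Types (u v : nat -> R) (l : nat -> nat).

Lemma window_max_ge (m : nat) u k : u k <= window_max m u k.
Proof.
rewrite /window_max; elim: (index_iota _ _) => [|j s IH]; first by rewrite big_nil.
by rewrite big_cons le_max IH orbT.
Qed.

Lemma window_max_le (m : nat) u k lk :
  window_argmax m u k lk -> window_max m u k <= u lk.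
Proof.
move=> [_ H]; rewrite /window_max big_seq.
elim/big_rec: _ => [|j x]; first by apply: H; rewrite leq_subr leqnn.
rewrite mem_index_iota ltnS => jk xl.
by rewrite ge_max xl andbT H.
Qed.

Context (m : nat) (u : nat -> R) (l : nat -> nat).
Hypothesis l_argmax : forall k, window_argmax m u k (l k).
Hypothesis u_next : forall k, u k.+1 <= u (l k).

Lemma window_le k j : (k - m <= j <= k)%N -> u j <= u (l k).
Proof. by have [_] := l_argmax k; apply. Qed.

Lemma window_succ k : u (l k.+1) <= u (l k).
Proof.
have [/andP[lo hi] _] := l_argmax k.+1.
have [->|lk] := eqVneq (l k.+1) k.+1; first exact: u_next.
apply: window_le; apply/andP; split.
  by apply: leq_trans lo; rewrite leq_sub2r.
by rewrite -ltnS ltn_neqAle lk hi.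
Qed.

Lemma window_antitone i j : (i <= j)%N -> u (l j) <= u (l i).
Proof.
move=> /subnKC <-; elim: (j - i)%N => [|d IH]; first by rewrite addn0.
by rewrite addnS; apply: le_trans (window_succ _) IH.
Qed.

(** Grippo-Lampariello-Lucidi: a term of the sequence that is not yet close to
    the limit [Fb] of the window maxima is followed, at most [m] steps later, by
    a window maximum, which is at least [Fb]; going back one step at a time
    from there, sufficient decrease forces the step [v] to be small, hence the
    previous value to be close to [Fb] too. *)
Lemma window_limit v (c C Fb : R) : 0 < c -> 0 <= C ->
  (forall k, 0 <= v k) ->
  (forall k, u k.+1 <= u (l k) - c * v k ^+ 2) ->
  (forall k, u k.+1 - u k <= C * v k) ->
  (forall k, Fb <= u (l k)) ->
  (forall eps, 0 < eps -> exists K, forall k, (K <= k)%N -> u (l k) <= Fb + eps) ->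
  forall eps, 0 < eps -> exists K, forall k, (K <= k)%N ->
    Fb - eps <= u k /\ v k <= eps.
Proof.
move=> c0 C0 v0 dec step low lim.
have small_step eps : 0 < eps -> exists2 e, 0 < e & forall k,
    u (l k) <= Fb + e -> Fb - e <= u k.+1 -> v k <= eps.
  move=> e0; exists (c * eps ^+ 2 / 2) => [|k].
    by rewrite divr_gt0 // mulr_gt0 // exprn_gt0.
  move=> h1 h2; have h := dec k.
  rewrite -(@ler_pXn2r _ 2) ?nnegrE ?(ltW e0) // -(ler_pM2l c0); lra.
have back j : forall eps, 0 < eps -> exists K, forall i, (K <= i)%N ->
    (exists2 s, (s <= j)%N & Fb <= u (i + s)%N) -> Fb - eps <= u i.
  elim: j => [|j IH] eps e0.
    by exists 0%N => i _ [s]; rewrite leqn0 => /eqP ->; rewrite addn0; lra.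
  have C1 : 0 < 2 * (C + 1) by lra.
  have [e' e'0 He'] := small_step _ (divr_gt0 e0 C1).
  pose e1 := Num.min e' (eps / 2).
  have e10 : 0 < e1 by rewrite lt_min e'0 divr_gt0.
  have [K1 H1] := IH _ e10; have [K2 H2] := lim _ e10.
  exists (maxn K1 K2) => i; rewrite geq_max => /andP[iK1 iK2] [[|s] sj].
    by rewrite addn0; lra.
  rewrite addnS -addSn => us.
  have u1 : Fb - e1 <= u i.+1.
    by apply: H1; [exact: leqW|exists s].
  have e1e' : e1 <= e' by rewrite ge_min lexx.
  have e1e : e1 <= eps / 2 by rewrite ge_min lexx orbT.
  have vi : v i <= eps / (2 * (C + 1)).
    by apply: He'; [have := H2 _ iK2; lra|lra].
  have Cv : C * v i <= eps / 2.
    have : (C + 1) * v i <= eps / 2.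
      move: vi; rewrite ler_pdivlMr //; lra.
    by have := v0 i; lra.
  by have := step i; lra.
have tail eps : 0 < eps -> exists K, forall i, (K <= i)%N -> Fb - eps <= u i.
  move=> e0; have [K HK] := back m eps e0.
  exists K => i Ki; apply: HK => //.
  have [/andP[lo hi] _] := l_argmax (i + m).
  exists (l (i + m) - i)%N; first by rewrite leq_subLR.
  by rewrite addnK in lo; rewrite subnKC.
move=> eps e0; have [e' e'0 He'] := small_step _ e0.
have [K1 H1] := tail _ e0; have [K2 H2] := tail _ e'0.
have [K3 H3] := lim _ e'0.
exists (maxn K1 (maxn K2 K3)) => k; rewrite !geq_max => /and3P[k1 k2 k3].
split; first exact: H1.
by apply: He'; [exact: H3|apply: H2; exact: leqW].
Qed.

Lemma window_inf (F0 : R) : (forall k, F0 <= u (l k)) ->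
  exists Fb, (forall k, Fb <= u (l k)) /\
    forall eps, 0 < eps -> exists K, forall k, (K <= k)%N -> u (l k) <= Fb + eps.
Proof.
move=> low; pose A := range (fun k => u (l k)).
have infA : has_inf A.
  split; first by exists (u (l 0%N)); exists 0%N.
  by exists F0 => _ [k _ <-].
exists (inf A); split.
  by move=> k; apply: ge_inf; [case: infA|exists k].
move=> eps e0; have [_ [K _ <-] HK] := inf_adherent e0 infA.
by exists K => k Kk; apply: le_trans (window_antitone Kk) (ltW HK).
Qed.

Lemma bernoulli_le (x : R) (k : nat) : 0 <= x <= 1 -> 1 - k%:R * x <= (1 - x) ^+ k.
Proof.
move=> /andP[x0 x1]; elim: k => [|k IH]; first by rewrite mul0r subr0 expr0.
rewrite exprS -natr1.
have k0 : 0 <= k%:R :> R by [].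
have : (1 - x) * (1 - k%:R * x) <= (1 - x) * (1 - x) ^+ k.
  by rewrite ler_wpM2l // subr_ge0.
have : 0 <= k%:R * x ^+ 2 by rewrite mulr_ge0 ?sqr_ge0.
lra.
Qed.

(** One contraction per [m + 1] steps, since after that many steps the window
    only contains contracted terms; spread over the steps, the rate is any [tau]
    with [q <= tau ^+ (m + 1)], such as Bernoulli's inequality provides. *)
Lemma window_linear_rate (F0 q : R) (K : nat) : 0 < q < 1 ->
  (forall k, F0 <= u (l k)) ->
  (forall k, (K <= k)%N -> u k.+1 - F0 <= q * (u (l k) - F0)) ->
  exists mu tau : R, [/\ 0 < mu, 0 < tau, tau < 1 &
    forall k, (K < k)%N -> u k - F0 <= mu * tau ^+ (k - K) * (u (l K) - F0)].
Proof.
move=> /andP[q0 q1] low contr.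
have m1 : 0 < m.+1%:R :> R by rewrite ltr0n.
pose x := (1 - q) / m.+1%:R.
have x0 : 0 < x by rewrite divr_gt0 // subr_gt0.
have x1 : x < 1.
  rewrite ltr_pdivrMr // mul1r; have : 1 <= m.+1%:R :> R by rewrite ler1n.
  lra.
pose tau := 1 - x; have tau0 : 0 < tau by rewrite subr_gt0.
have tau1 : tau < 1 by rewrite /tau; lra.
have qtau : q <= tau ^+ m.+1.
  apply: le_trans (@bernoulli_le x m.+1 _); last by rewrite !ltW.
  by rewrite mulrC divfK ?gt_eqF //; lra.
have tm0 : 0 < tau ^+ m.+1 by rewrite exprn_gt0.
exists (tau ^+ m.+1)^-1, tau; split=> //; first by rewrite invr_gt0.
have b0 k : 0 <= u (l k) - F0 by rewrite subr_ge0.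
have shrink k : (K <= k)%N -> u (l (k + m.+1)%N) - F0 <= q * (u (l k) - F0).
  move=> Kk; have [/andP[lo hi] _] := l_argmax (k + m.+1).
  move: lo hi; rewrite addnS subSn ?leq_addl // addnK.
  case: (l _) => // i; rewrite !ltnS => ki _.
  apply: le_trans (contr _ (leq_trans Kk ki)) _.
  by rewrite ler_pM2l // lerD2r window_antitone.
have rate : forall d, u (l (K + d)%N) - F0 <=
    (tau ^+ m.+1)^-1 * tau ^+ d * (u (l K) - F0).
  move=> d; elim: d {-2}d (leqnn d) => [|D IH] d dD.
    move: dD; rewrite leqn0 => /eqP ->; rewrite addn0 expr0 mulr1 ler_peMl //.
    by rewrite invf_ge1 // exprn_ile1 // ltW.
  have [md|dm] := leqP m.+1 d; last first.
    apply: (@le_trans _ _ (u (l K) - F0)).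
      by rewrite lerD2r window_antitone // leq_addr.
    rewrite ler_peMl // mulrC ler_pdivlMr // mul1r.
    by rewrite ler_wiXn2l ?(ltW tau0) ?(ltW tau1) // ltnW.
  have -> : (K + d = K + (d - m.+1) + m.+1)%N by rewrite -addnA subnK.
  apply: le_trans (shrink _ (leq_addr _ _)) _.
  apply: (@le_trans _ _ (q * ((tau ^+ m.+1)^-1 * tau ^+ (d - m.+1) * (u (l K) - F0)))).
    rewrite ler_pM2l //; apply: IH.
    by rewrite leq_subLR (leq_trans dD) // addSn ltnS leq_addl.
  rewrite -{2}(subnK md) exprD; set y := tau ^+ (d - m.+1).
  have y0 : 0 <= y by rewrite exprn_ge0 // ltW.
  have z0 : 0 <= (tau ^+ m.+1)^-1 * y * (u (l K) - F0).
    by rewrite !mulr_ge0 ?invr_ge0 ?(ltW tm0).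
  rewrite [leRHS](_ : _ = tau ^+ m.+1 * ((tau ^+ m.+1)^-1 * y * (u (l K) - F0))).
    by rewrite ler_wpM2r.
  by move: (tau ^+ m.+1) => T; ring.
move=> k Kk; apply: le_trans (_ : u k - F0 <= u (l k) - F0) _.
  by rewrite lerD2r window_le // leqnn leq_subr.
by have := rate (k - K)%N; rewrite subnKC // ltnW.
Qed.

End Window.

(** * The proximal quasi-Newton iteration *)

Section Iteration.
Context {R : realType} {n r : nat}.
Local Notation mat := 'M[R]_(n, r).
Implicit Types (X Y V W : mat).

Lemma convex_segment (h : mat -> R) X V (t : R) :
  convex_function [set: convex_lmodType mat] h -> 0 <= t <= 1 ->
  h (X + t *: V) <= (1 - t) * h X + t * h (X + V).
Proof.
move=> hc /andP[t0 t1].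
have := hc (Itv01 t0 t1) (X + V) X; rewrite !inE => /(_ I I).
rewrite convRE /= => H.
have -> : X + t *: V = t *: (X + V) + (1 - t) *: X.
  by rewrite scalerDr scalerBl scale1r [RHS]addrC addrA subrK.
by rewrite [leRHS]addrC; exact: H.
Qed.

Context (f : mat -> R^o) (h : mat -> R) (G : mat -> mat) (L Lh : R).
Context (Rt : mat -> mat -> mat) (M1 M2 : R).
Hypothesis L0 : 0 <= L.
Hypothesis fG : forall Y,
  differentiable f Y /\ forall V, 'D_V f Y = inner (G Y) V.
Hypothesis GL : forall X Y, fnorm (G X - G Y) <= L * fnorm (X - Y).
Hypothesis h_convex : convex_function [set: convex_lmodType mat] h.
Hypotheses (Lh0 : 0 <= Lh) (hL : frob_lipschitz Lh h).
Hypotheses (M10 : 0 < M1) (M20 : 0 < M2).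
Hypothesis RM1 : forall Y xi, stiefel Y -> tangent Y xi ->
  fnorm (Rt Y xi - Y) <= M1 * fnorm xi.
Hypothesis RM2 : forall Y xi, stiefel Y -> tangent Y xi ->
  fnorm (Rt Y xi - Y - xi) <= M2 * fnorm xi ^+ 2.
Context (g : R).
Hypothesis Gg : forall X, stiefel X -> fnorm (G X) <= g.

Let F X : R := f X + h X.

(** Along a trial step the convex function [h] is bounded by interpolation; the
    curvature of [f] and of the retraction only enters at second order in the
    step. *)
Lemma trial_point X V (a : R) : stiefel X -> tangent X V -> 0 <= a <= 1 ->
  F (Rt X (a *: V)) <= (1 - a) * F X + a * (f X + inner (G X) V + h (X + V))
    + (g * M2 + L * M1 ^+ 2 + Lh * M2) * a ^+ 2 * fnorm V ^+ 2.
Proof.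
move=> sX TV a01; have /andP[a0 a1] := a01; have Lp := L0; have Lhp := Lh0.
have TaV := tangentZ a TV.
set Y := Rt X (a *: V).
have h1 := RM1 sX TaV; have h2 := RM2 sX TaV; rewrite -/Y in h1 h2.
rewrite fnormZ (ger0_norm a0) in h1 h2; rewrite exprMn in h2.
have sb := smooth_bound L0 fG GL X Y; rewrite ler_norml in sb.
have {sb} /andP[_ sb] := sb.
have LY : L * fnorm (Y - X) ^+ 2 <= L * (M1 * (a * fnorm V)) ^+ 2.
  rewrite ler_wpM2l // ler_pXn2r // ?nnegrE ?fnorm_ge0 //.
  by rewrite !mulr_ge0 ?fnorm_ge0 ?(ltW M10).
have iE : inner (G X) (Y - X) = a * inner (G X) V + inner (G X) (Y - X - a *: V).
  by rewrite (innerBr _ (Y - X)) innerZr; lra.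
have g0 : 0 <= g by apply: le_trans (Gg sX); exact: fnorm_ge0.
have i2 : inner (G X) (Y - X - a *: V) <= g * (M2 * (a ^+ 2 * fnorm V ^+ 2)).
  by rewrite (le_trans (inner_le_fnorm _ _)) // ler_pM ?fnorm_ge0 ?Gg.
have hY := lipschitz_le hL Y (X + a *: V).
have hY2 : Lh * fnorm (Y - (X + a *: V)) <= Lh * (M2 * (a ^+ 2 * fnorm V ^+ 2)).
  by rewrite ler_wpM2l // opprD addrA.
have hc := convex_segment X V h_convex a01.
rewrite /F; move: sb; rewrite iE => sb.
move: (inner (G X) V) (inner (G X) (Y - X - a *: V)) i2 sb => p q i2 sb.
rewrite !exprMn in LY; lra.
Qed.

Lemma objective_step (s : R) X Y : (forall Z : mat, stiefel Z -> fnorm Z <= s) ->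
  stiefel X -> stiefel Y ->
  F Y - F X <= (g + 2 * L * s + Lh) * fnorm (Y - X).
Proof.
move=> sb sX sY; have Lp := L0.
have := smooth_bound L0 fG GL X Y; rewrite ler_norml => /andP[_ h1].
have h2 := lipschitz_le hL Y X.
have h3 : inner (G X) (Y - X) <= g * fnorm (Y - X).
  by rewrite (le_trans (inner_le_fnorm _ _)) // ler_wpM2r ?fnorm_ge0 ?Gg.
have h4 : L * fnorm (Y - X) ^+ 2 <= L * (2 * s * fnorm (Y - X)).
  rewrite ler_wpM2l // expr2 ler_wpM2r ?fnorm_ge0 //.
  apply: (le_trans (fnormBD _ _)); have := sb _ sX; have := sb _ sY; lra.
by rewrite /F; lra.
Qed.

Context (B : mat -> mat) (kappa : R).

(** Comparison of the minimiser with [t *: W]: by convexity the linearised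
    objective gains a factor [t], while the quadratic term costs only [t ^ 2]. *)
Lemma argmin_le X V W (t : R) :
  (forall W, tangent X W -> inner (G X) V + 2^-1 * sqnormB B V + h (X + V)
     <= inner (G X) W + 2^-1 * sqnormB B W + h (X + W)) ->
  0 <= sqnormB B V ->
  (forall W, tangent X W -> sqnormB B W <= kappa * fnorm W ^+ 2) ->
  tangent X W -> 0 <= t <= 1 ->
  inner (G X) V + h (X + V) - h X <=
  t * (inner (G X) W + h (X + W) - h X) + t ^+ 2 * (2^-1 * (kappa * fnorm W ^+ 2)).
Proof.
move=> Vmin V0 Bk TW t01; have /andP[t0 t1] := t01.
have TtW := tangentZ t TW.
have := Vmin _ TtW; have := Bk _ TtW; rewrite innerZr fnormZ (ger0_norm t0) exprMn.
have := convex_segment X W h_convex t01; lra.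
Qed.

End Iteration.

Section Convergence.
Context {R : realType} {n r : nat}.
Local Notation mat := 'M[R]_(n, r).

Lemma fnorm_stiefel (X : mat) : stiefel X -> fnorm X = fnorm (1%:M : 'M[R]_r).
Proof. by move=> sX; rewrite -{1}(mulmx1 X) fnorm_stiefel_mul. Qed.

Context (f : mat -> R^o) (h : mat -> R) (G H : mat -> mat) (L Lh : R).
Context (Rt : mat -> mat -> mat) (M1 M2 eta : R) (X0 : mat).
Hypothesis L0 : 0 <= L.
Hypothesis fG : forall Y,
  differentiable f Y /\ forall V, 'D_V f Y = inner (G Y) V.
Hypothesis GL : forall X Y, fnorm (G X - G Y) <= L * fnorm (X - Y).
Hypothesis dataf : second_order_data f X0 G H.
Hypothesis h_convex : convex_function [set: convex_lmodType mat] h.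
Hypotheses (Lh0 : 0 <= Lh) (hL : frob_lipschitz Lh h).
Hypotheses (M10 : 0 < M1) (M20 : 0 < M2).
Hypothesis Rst : forall Y xi, stiefel Y -> tangent Y xi -> stiefel (Rt Y xi).
Hypothesis RM1 : forall Y xi, stiefel Y -> tangent Y xi ->
  fnorm (Rt Y xi - Y) <= M1 * fnorm xi.
Hypothesis RM2 : forall Y xi, stiefel Y -> tangent Y xi ->
  fnorm (Rt Y xi - Y - xi) <= M2 * fnorm xi ^+ 2.
Hypothesis eta_gt : 5 * Lh * M2 < eta.
Hypothesis pullback : stiefel X0 -> forall eps : R, 0 < eps ->
  exists2 d, 0 < d & forall z, tangent X0 z -> fnorm z <= d ->
    f X0 + inner (G X0) z + (eta / 2 - eps) * fnorm z ^+ 2 <= f (Rt X0 z).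

Context (gamma sigma kap1 kap2 : R) (m : nat).
Context (B : nat -> mat -> mat) (X V : nat -> mat) (N l : nat -> nat).
Hypotheses (gamma_01 : 0 < gamma < 1) (sigma_01 : 0 < sigma < 1).
Hypotheses (kap1_gt0 : 0 < kap1) (kap2_ge0 : 0 <= kap2).
Let u k : R := f (X k) + h (X k).
Hypothesis X_start : stiefel (X 0%N).
Hypothesis V_tangent : forall k, tangent (X k) (V k).
Hypothesis V_min : forall k W, tangent (X k) W ->
  inner (G (X k)) (V k) + 2^-1 * sqnormB (B k) (V k) + h (X k + V k)
  <= inner (G (X k)) W + 2^-1 * sqnormB (B k) W + h (X k + W).
Hypothesis X_next : forall k, X k.+1 = Rt (X k) (gamma ^+ N k *: V k).
Hypothesis B_bounds : forall k W, tangent (X k) W ->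
  kap1 * fnorm W ^+ 2 <= sqnormB (B k) W <= kap2 * fnorm W ^+ 2.
Hypothesis l_argmax : forall k, window_argmax m u k (l k).
Hypothesis accept : forall k,
  u k.+1 <= u (l k) - 2^-1 * sigma * gamma ^+ N k * sqnormB (B k) (V k).
Hypothesis reject : forall k j, (j < N k)%N ->
  u k - 2^-1 * sigma * gamma ^+ j * sqnormB (B k) (V k)
  < f (Rt (X k) (gamma ^+ j *: V k)) + h (Rt (X k) (gamma ^+ j *: V k)).
Hypothesis X0_acc : forall (eps : R) (K : nat), 0 < eps ->
  exists2 k, (K <= k)%N & fnorm (X k - X0) <= eps.

Lemma iterate_stiefel k : stiefel (X k).
Proof.
by elim: k => [|k IH] //; rewrite X_next; apply: Rst => //; exact: tangentZ.
Qed.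

Lemma limit_stiefel : stiefel X0.
Proof.
rewrite /stiefel /=; apply/eqP; rewrite -subr_eq0; apply/eqP/fnorm_eq0/eqP.
rewrite eq_le fnorm_ge0 andbT; apply/ler_addgt0Pr => eps e0; rewrite add0r.
set s := fnorm (1%:M : 'M[R]_r).
have s0 : 0 <= s := fnorm_ge0 _.
have c0 : 0 < 2 * s + 1 by lra.
pose e := Num.min 1 (eps / (2 * s + 1)).
have ee : 0 < e by rewrite lt_min ltr01 divr_gt0.
have [k _ kX] := X0_acc 0 ee; have sX := iterate_stiefel k.
have kX1 : fnorm (X k - X0) <= 1 by rewrite (le_trans kX) // ge_min lexx.
have kX2 : fnorm (X k - X0) * (2 * s + 1) <= eps.
  by rewrite -ler_pdivlMr // (le_trans kX) // ge_min lexx orbT.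
rewrite -[1%:M]sX (le_trans (fnorm_gramB _ _)) // fnormB (fnorm_stiefel sX) -/s.
have : fnorm X0 <= s + 1.
  have := fnorm_split X0 (X k) 0; rewrite !subr0 (fnorm_stiefel sX) -/s fnormB.
  lra.
have := fnorm_ge0 (X k - X0); nra.
Qed.

Let g := fnorm (G X0) + L * (2 * fnorm (1%:M : 'M[R]_r)).

Lemma grad_stiefel_le Y : stiefel Y -> fnorm (G Y) <= g.
Proof.
move=> sY; have h1 := fnormD (G Y - G X0) (G X0); rewrite subrK in h1.
have h2 := fnormBD Y X0.
rewrite (fnorm_stiefel sY) (fnorm_stiefel limit_stiefel) in h2.
have h3 : L * fnorm (Y - X0) <= L * (2 * fnorm (1%:M : 'M[R]_r)).
  by rewrite ler_wpM2l //; lra.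
by have := GL Y X0; rewrite /g; lra.
Qed.

Let g_ge0 : 0 <= g.
Proof.
by apply: le_trans (grad_stiefel_le limit_stiefel); exact: fnorm_ge0.
Qed.

Let C := g * M2 + L * M1 ^+ 2 + Lh * M2.

Let C_ge0 : 0 <= C.
Proof.
apply: addr_ge0; last exact: mulr_ge0 Lh0 (ltW M20).
exact: addr_ge0 (mulr_ge0 g_ge0 (ltW M20)) (mulr_ge0 L0 (sqr_ge0 M1)).
Qed.

Let sqB_ge0 k : 0 <= sqnormB (B k) (V k).
Proof.
have /andP[lo _] := B_bounds (V_tangent k).
by apply: le_trans lo; rewrite mulr_ge0 ?sqr_ge0 ?(ltW kap1_gt0).
Qed.

Let gammaX_01 k : 0 < gamma ^+ k <= 1.
Proof.
have /andP[g0 g1] := gamma_01; rewrite exprn_gt0 //=.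
by rewrite exprn_ile1 // ltW.
Qed.

(** Backtracking stops at a step size bounded below: below [bar] the decrease of
    the model dominates the second-order errors, so a rejected trial step is
    longer than [bar]. *)
Lemma step_size_lower :
  exists2 amin, 0 < amin <= 1 & forall k, amin <= gamma ^+ N k.
Proof.
have /andP[g0 g1] := gamma_01; have /andP[s0 s1] := sigma_01.
have Cp := C_ge0; have k1p := kap1_gt0.
pose bar := 2^-1 * (1 - sigma) * kap1 / (C + 1).
have bar0 : 0 < bar by rewrite divr_gt0 ?mulr_gt0 //; lra.
exists (Num.min 1 (gamma * bar)).
  by rewrite lt_min ltr01 mulr_gt0 //= ge_min lexx.
move=> k; case E : (N k) => [|j]; first by rewrite expr0 ge_min lexx.
rewrite ge_min; apply/orP; right; rewrite exprS ler_pM2l // leNgt.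
apply/negP => jbar.
have jN : (j < N k)%N by rewrite E.
have := reject jN; rewrite ltNge => /negP; apply.
have a01 := gammaX_01 j; move: jbar a01; set a := gamma ^+ j => jbar /andP[a0 a1].
have a01 : 0 <= a <= 1 by rewrite (ltW a0).
have tp := trial_point L0 fG GL h_convex Lh0 hL M10 RM1 RM2 grad_stiefel_le
  (iterate_stiefel k) (V_tangent k) a01.
apply: (le_trans tp); rewrite -/C.
have := V_min (tangent0 (X k)).
rewrite inner0r addr0 {2}/sqnormB inner0l mulr0 !add0r => V0.
have /andP[lo _] := B_bounds (V_tangent k).
move: V0 lo; set b := sqnormB _ _ => V0 lo.
have aC : a * C <= 2^-1 * (1 - sigma) * kap1.
  have : a * (C + 1) <= 2^-1 * (1 - sigma) * kap1.
    have Cp1 : 0 < C + 1 by lra.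
    by rewrite -ler_pdivlMr //; apply: ltW.
  lra.
have v0 : 0 <= fnorm (V k) ^+ 2 by exact: sqr_ge0.
have q1 : a * C * fnorm (V k) ^+ 2 <= 2^-1 * (1 - sigma) * b.
  apply: (@le_trans _ _ (2^-1 * (1 - sigma) * (kap1 * fnorm (V k) ^+ 2))).
    by rewrite [leRHS]mulrA ler_wpM2r.
  by rewrite ler_wpM2l // mulr_ge0 //; lra.
have q2 : a * (a * C * fnorm (V k) ^+ 2) <= a * (2^-1 * (1 - sigma) * b).
  by rewrite ler_wpM2l // ltW.
have q3 : a * (inner (G (X k)) (V k) + 2^-1 * b + h (X k + V k)) <= a * h (X k).
  by rewrite ler_wpM2l // ltW.
rewrite /u; lra.
Qed.

(** If the first-order model at [X0] had a negative value along [W], then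
    [argmin_le], with [t] so small that the quadratic term costs at most half of
    it, would give a decrease bounded away from [0] at iterates near [X0], where
    the model decrease vanishes with [V k]. *)
Lemma limit_stationary :
  (forall eps : R, 0 < eps -> exists2 k, fnorm (X k - X0) <= eps & fnorm (V k) <= eps) ->
  forall W, tangent X0 W -> 0 <= inner (G X0) W + h (X0 + W) - h X0.
Proof.
move=> XV W TW; rewrite leNgt; apply/negP.
set s0 := _ - h X0 => s0_lt; have Lp := L0; have Lhp := Lh0; have gp := g_ge0.
have k2 := kap2_ge0.
set w := fnorm W; have w0 : 0 <= w := fnorm_ge0 _.
have G0n := fnorm_ge0 (G X0).
pose K2 := 2^-1 * (kap2 * w ^+ 2).
have K20 : 0 <= K2 by rewrite !mulr_ge0 ?sqr_ge0.
pose t := Num.min 1 (- s0 / (2 * (K2 + 1))).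
have t0 : 0 < t by rewrite lt_min ltr01 divr_gt0 //; lra.
have t1 : t <= 1 by rewrite ge_min lexx.
have tK : t * (2 * (K2 + 1)) <= - s0.
  by rewrite -ler_pdivlMr ?ge_min ?lexx ?orbT //; lra.
have tK' : t ^+ 2 * K2 <= t * (- s0 / 2).
  by rewrite expr2 -mulrA ler_pM2l //; lra.
pose C5 := L * w + fnorm (G X0) * w + Lh * (2 + w).
have C50 : 0 <= C5 by rewrite !addr_ge0 ?mulr_ge0 //; lra.
pose D := C5 + g + Lh + 1.
have D0 : 0 < D by rewrite /D; lra.
pose e := t * (- s0 / 2) / D.
have e0 : 0 < e by rewrite divr_gt0 // mulr_gt0 //; lra.
have eE : t * (- s0 / 2) = e * D by rewrite /e divfK // gt_eqF.
clearbody e t; have [k kX kV] := XV e e0.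
have sX := iterate_stiefel k.
pose Wk := tproj (X k) W; have TWk : tangent (X k) Wk by exact: tproj_tangent.
have Wkn : fnorm Wk <= w by exact: fnorm_tproj_le.
have WkW : fnorm (Wk - W) <= e * w.
  by apply: (le_trans (tproj_transport sX TW)); rewrite -/w ler_wpM2r.
have t01 : 0 <= t <= 1 by rewrite (ltW t0).
have Bk W' : tangent (X k) W' -> sqnormB (B k) W' <= kap2 * fnorm W' ^+ 2.
  by move=> /B_bounds /andP[].
have am := argmin_le h_convex (@V_min k) (sqB_ge0 k) Bk TWk t01.
have lhs : - ((g + Lh) * e) <=
    inner (G (X k)) (V k) + h (X k + V k) - h (X k).
  have h1 := lipschitz_le hL (X k) (X k + V k).
  have h2 : fnorm (X k - (X k + V k)) = fnorm (V k).
    by rewrite opprD addrA subrr add0r fnormN.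
  rewrite h2 in h1.
  have h3 : - inner (G (X k)) (V k) <= g * e.
    rewrite -innerNr (le_trans (inner_le_fnorm _ _)) // fnormN.
    by rewrite ler_pM ?fnorm_ge0 ?grad_stiefel_le.
  have h4 : Lh * fnorm (V k) <= Lh * e by rewrite ler_wpM2l.
  lra.
have i1 : inner (G (X k)) Wk <= inner (G X0) W + (L * w + fnorm (G X0) * w) * e.
  have -> : inner (G (X k)) Wk = inner (G X0) W + inner (G (X k) - G X0) Wk
      + inner (G X0) (Wk - W) by rewrite innerBl innerBr; ring.
  have h1 : inner (G (X k) - G X0) Wk <= L * e * w.
    rewrite (le_trans (inner_le_fnorm _ _)) // ler_pM ?fnorm_ge0 //.
    by rewrite (le_trans (GL _ _)) // ler_wpM2l.
  have h2 : inner (G X0) (Wk - W) <= fnorm (G X0) * (e * w).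
    by rewrite (le_trans (inner_le_fnorm _ _)) // ler_wpM2l.
  lra.
have i2 : h (X k + Wk) <= h (X0 + W) + Lh * (e + e * w).
  have h1 := lipschitz_le hL (X k + Wk) (X0 + W).
  have h2 : fnorm (X k + Wk - (X0 + W)) <= e + e * w.
    rewrite opprD addrACA (le_trans (fnormD _ _)) //; lra.
  have h3 : Lh * fnorm (X k + Wk - (X0 + W)) <= Lh * (e + e * w).
    by rewrite ler_wpM2l.
  lra.
have i3 : - h (X k) <= - h X0 + Lh * e.
  have h1 := lipschitz_le hL X0 (X k); rewrite fnormB in h1.
  have h3 : Lh * fnorm (X k - X0) <= Lh * e by rewrite ler_wpM2l.
  lra.
have i4 : inner (G (X k)) Wk + h (X k + Wk) - h (X k) <= s0 + C5 * e.
  by rewrite /s0 /C5; lra.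
have i5 : t * (inner (G (X k)) Wk + h (X k + Wk) - h (X k)) <= t * (s0 + C5 * e).
  by rewrite ler_pM2l.
have i6 : t * (C5 * e) <= C5 * e by rewrite ler_piMl // mulr_ge0 // ltW.
have i7 : t ^+ 2 * (2^-1 * (kap2 * fnorm Wk ^+ 2)) <= t ^+ 2 * K2.
  rewrite ler_wpM2l ?sqr_ge0 // ler_wpM2l ?invr_ge0 // ler_wpM2l //.
  by rewrite ler_pXn2r ?nnegrE ?fnorm_ge0.
have : e * D <= e * (D - 1) by rewrite /D in eE *; lra.
by rewrite ler_pM2l //; lra.
Qed.

Let F0 : R := f X0 + h X0.
Let CF := g + 2 * L * fnorm (1%:M : 'M[R]_r) + Lh.

Let CF_ge0 : 0 <= CF.
Proof.
apply: addr_ge0 => //; apply: addr_ge0 => //.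
by rewrite !mulr_ge0 ?fnorm_ge0.
Qed.

Lemma objective_lipschitz Y Z : stiefel Y -> stiefel Z ->
  f Z + h Z - (f Y + h Y) <= CF * fnorm (Z - Y).
Proof.
apply: (objective_step L0 fG GL hL grad_stiefel_le).
by move=> A sA; rewrite (fnorm_stiefel sA).
Qed.

Lemma sufficient_decrease : exists2 c, 0 < c &
  forall k, u k.+1 <= u (l k) - c * fnorm (V k) ^+ 2.
Proof.
have [amin /andP[am0 _] Ha] := step_size_lower.
have /andP[s0 _] := sigma_01.
exists (2^-1 * sigma * amin * kap1); first by rewrite !mulr_gt0 ?invr_gt0.
move=> k; apply: (le_trans (accept k)); rewrite lerD2l lerN2.
rewrite -[leLHS]mulrA; have /andP[lo _] := B_bounds (V_tangent k).
rewrite ler_pM //.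
- by rewrite !mulr_ge0 ?invr_ge0 // ltW.
- by rewrite mulr_ge0 ?sqr_ge0 // ltW.
- by rewrite ler_pM2l ?mulr_gt0 ?invr_gt0.
Qed.

Lemma iterate_step k : fnorm (X k.+1 - X k) <= M1 * fnorm (V k).
Proof.
rewrite X_next; apply: (le_trans (RM1 (iterate_stiefel k) (tangentZ _ (V_tangent k)))).
have /andP[a0 a1] := gammaX_01 (N k).
rewrite ler_wpM2l ?(ltW M10) // fnormZ ger0_norm ?(ltW a0) //.
by rewrite ler_piMl ?fnorm_ge0.
Qed.

Let u_next k : u k.+1 <= u (l k).
Proof.
have [c c0 dec] := sufficient_decrease; apply: (le_trans (dec k)).
by rewrite gerBl mulr_ge0 ?sqr_ge0 // ltW.
Qed.

Lemma window_max_ge_limit k : F0 <= u (l k).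
Proof.
apply/ler_addgt0Pr => eps e0.
have C1 : 0 < CF + 1 by rewrite ltr_wpDl.
have [k' kk' kX] := X0_acc k (divr_gt0 e0 C1).
have h1 := objective_lipschitz (iterate_stiefel k') limit_stiefel.
rewrite fnormB in h1; have h2 := window_antitone l_argmax u_next kk'.
have h3 : u k' <= u (l k').
  by apply: (window_le l_argmax); rewrite leqnn leq_subr.
have h4 : fnorm (X k' - X0) * (CF + 1) <= eps by rewrite -ler_pdivlMr.
have := fnorm_ge0 (X k' - X0); move: h1 h2 h3 h4; rewrite -/F0 -/(u k').
move: (fnorm _) (CF) => x c *; lra.
Qed.

(** The limit of the window maxima is [F0], since by [window_limit] it is the limit
    of the objective, which approaches [F0] along a subsequence. *)
Lemma iterate_limits (eps : R) : 0 < eps ->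
  exists K, forall k, (K <= k)%N -> u k <= F0 + eps /\ fnorm (V k) <= eps.
Proof.
have [c c0 dec] := sufficient_decrease.
have [Fb [low lim]] := window_inf l_argmax u_next window_max_ge_limit.
have step k : u k.+1 - u k <= (CF * M1) * fnorm (V k).
  apply: (le_trans (objective_lipschitz (iterate_stiefel k) (iterate_stiefel k.+1))).
  by rewrite -[leRHS]mulrA ler_wpM2l // iterate_step.
have CM : 0 <= CF * M1 by rewrite mulr_ge0 // ltW.
have wl := window_limit l_argmax c0 CM (fun k => fnorm_ge0 (V k)) dec step low lim.
have FbF0 : Fb <= F0.
  apply/ler_addgt0Pr => e e0.
  have C1 : 0 < CF + 1 by rewrite ltr_wpDl.
  have [K HK] := wl _ (divr_gt0 e0 (ltr0Sn _ 1)).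
  have [k Kk kX] := X0_acc K (divr_gt0 (divr_gt0 e0 (ltr0Sn _ 1)) C1).
  have [h1 _] := HK k Kk.
  have h2 := objective_lipschitz limit_stiefel (iterate_stiefel k).
  have h4 : fnorm (X k - X0) * (CF + 1) <= e / 2 by rewrite -ler_pdivlMr.
  have := fnorm_ge0 (X k - X0); move: h1 h2 h4; rewrite -/F0 -/(u k).
  move: (fnorm _) (CF) => x c' *; lra.
move=> e0; have [K1 H1] := wl _ e0; have [K2 H2] := lim _ e0.
exists (maxn K1 K2) => k; rewrite geq_max => /andP[k1 k2].
split; last by have [] := H1 k k1.
apply: le_trans (le_trans (H2 k k2) _); last by rewrite lerD2r.
by apply: (window_le l_argmax); rewrite leqnn leq_subr.
Qed.

Let eta_ge0 : 0 <= eta.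
Proof. by apply: ltW (le_lt_trans _ eta_gt); rewrite !mulr_ge0 // ltW. Qed.

Let c1 := (eta / 2 - Lh * M2) / 2.

Let c1_gt0 : 0 < c1.
Proof.
have h1 : 0 <= Lh * M2 by rewrite mulr_ge0 // ltW.
by have h2 := eta_gt; rewrite /c1; lra.
Qed.

(** Quadratic growth keeps the iterates in a small ball once they have entered
    it with small steps and an objective close to [F0]. *)
Lemma iterates_converge (d : R) : 0 < d ->
  exists K, forall k, (K <= k)%N -> fnorm (X k - X0) <= d.
Proof.
move=> d0; have sX0 := limit_stiefel.
have stat : forall W, tangent X0 W -> 0 <= inner (G X0) W + h (X0 + W) - h X0.
  apply: limit_stationary => eps e0; have [K HK] := iterate_limits e0.
  by have [k Kk kX] := X0_acc K e0; exists k => //; have [] := HK k Kk.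
have [d1 d10 QG] := quadratic_growth L0 fG GL M20 sX0 eta_ge0
  (fun xi => Rst sX0) (fun xi => RM2 sX0) (pullback sX0) Lh0 hL stat c1_gt0.
pose e := Num.min d (d1 / 2).
have e0 : 0 < e by rewrite lt_min d0 divr_gt0.
have ed : e <= d by rewrite ge_min lexx.
have ed1 : e <= d1 / 2 by rewrite ge_min lexx orbT.
clearbody e.
have [K1 H1] := iterate_limits (mulr_gt0 c1_gt0 (exprn_gt0 2 e0)).
have [K2 H2] := iterate_limits (divr_gt0 e0 M10).
have [K K12 KX] := X0_acc (maxn K1 K2) e0.
have stay j : fnorm (X (K + j)%N - X0) <= e.
  elim: j => [|j IH]; first by rewrite addn0.
  have Kj : (maxn K1 K2 <= K + j)%N by rewrite (leq_trans K12) // leq_addr.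
  move: Kj; rewrite geq_max addnS => /andP[k1 k2].
  have [_ vk] := H2 _ k2.
  have mv : M1 * fnorm (V (K + j)) <= e by rewrite mulrC -ler_pdivlMr.
  have near1 : fnorm (X (K + j).+1 - X0) <= d1.
    apply: (le_trans (fnorm_split _ (X (K + j)%N) _)).
    by have := iterate_step (K + j); lra.
  have qg := QG _ (iterate_stiefel _) near1.
  have [uk _] := H1 _ (leqW k1).
  rewrite -(@ler_pXn2r _ 2) ?nnegrE ?fnorm_ge0 ?(ltW e0) // -(ler_pM2l c1_gt0).
  have cE : eta / 2 - Lh * M2 - c1 = c1 by rewrite /c1; lra.
  rewrite cE in qg; apply: (le_trans qg).
  by move: uk; rewrite /u -/F0; move: (_ + _) F0 => x y; lra.
exists K => k /subnKC <-; exact: le_trans (stay _) ed.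
Qed.

(** Near [X0] a step removes, up to an error [C * v ^+ 2], the fraction [a * t] of
    the gap to the optimal value; averaged with the sufficient decrease, which
    pays for the error, this contracts. *)
Lemma linear_convergence : exists (K : nat) (mu tau : R),
  [/\ 0 < mu, 0 < tau, tau < 1 & forall k, (K < k)%N ->
     u k - F0 <= mu * tau ^+ (k - K) * (u (l K) - F0)].
Proof.
have sX0 := limit_stiefel; have M2p := M20.
have [d d0 MD] := model_decrease L0 fG GL dataf M20 sX0 eta_ge0
  (fun xi => Rst sX0) (fun xi => RM2 sX0) (pullback sX0) Lh0 hL c1_gt0.
have [K HK] := iterates_converge d0.
have [amin /andP[am0 am1] Ha] := step_size_lower.
have [c c0 dec] := sufficient_decrease.
pose Kq := 2^-1 * kap2 * (1 + M2) ^+ 2.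
have Kq0 : 0 <= Kq.
  by apply: mulr_ge0; [exact: mulr_ge0|exact: sqr_ge0].
pose t := Num.min 1 (c1 / (Kq + 1)).
have Kq1 : 0 < Kq + 1 by lra.
have t0 : 0 < t by rewrite lt_min ltr01 divr_gt0.
have t1 : t <= 1 by rewrite ge_min lexx.
have tK : t * (Kq + 1) <= c1 by rewrite -ler_pdivlMr // ge_min lexx orbT.
clearbody t.
pose q := 1 - c * (amin * t) / (C + 1 + c).
have Cp := C_ge0; have D0 : 0 < C + 1 + c by lra.
have at0 : 0 < amin * t by rewrite mulr_gt0.
have at1 : amin * t <= 1 by rewrite mulr_ile1 ?(ltW am0) ?(ltW t0).
have q01 : 0 < q < 1.
  apply/andP; split; last by rewrite /q ltrBlDr ltrDl divr_gt0 // mulr_gt0.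
  rewrite /q subr_gt0 ltr_pdivrMr // mul1r.
  by apply: (@le_lt_trans _ _ c); [rewrite ler_piMr // ltW|lra].
suff contr k : (K <= k)%N -> u k.+1 - F0 <= q * (u (l k) - F0).
  have [mu [tau H']] := window_linear_rate l_argmax u_next q01
    window_max_ge_limit contr.
  by exists K, mu, tau.
move=> Kk; have sX := iterate_stiefel k.
have [W [TW Wn Wdec]] := MD _ sX (HK k Kk).
have t01 : 0 <= t <= 1 by rewrite (ltW t0).
have Bk W' : tangent (X k) W' -> sqnormB (B k) W' <= kap2 * fnorm W' ^+ 2.
  by move=> /B_bounds /andP[].
have am := argmin_le h_convex (@V_min k) (sqB_ge0 k) Bk TW t01.
have /andP[a0 a1] := gammaX_01 (N k); have aN := Ha k.
have a01 : 0 <= gamma ^+ N k <= 1 by rewrite (ltW a0).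
have tp := trial_point L0 fG GL h_convex Lh0 hL M10 RM1 RM2 grad_stiefel_le
  sX (V_tangent k) a01.
rewrite -X_next -/(u k) -/(u k.+1) -/C in tp.
move: tp aN a0 a1 {a01}; set a := gamma ^+ N k => tp aN a0 a1.
have decr := dec k.
set v := fnorm (V k) ^+ 2 in tp decr; have v0 : 0 <= v by exact: sqr_ge0.
pose b := u (l k) - F0.
have b0 : 0 <= b by rewrite subr_ge0 window_max_ge_limit.
have ub : u k - F0 <= b.
  by rewrite lerD2r (window_le l_argmax) // leqnn leq_subr.
have wx : fnorm W ^+ 2 <= (1 + M2) ^+ 2 * fnorm (X k - X0) ^+ 2.
  rewrite -exprMn ler_pXn2r ?nnegrE ?fnorm_ge0 // mulr_ge0 ?fnorm_ge0 //; lra.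
move: wx Wdec; set x := fnorm (X k - X0) ^+ 2 => wx Wdec.
have x0 : 0 <= x by exact: sqr_ge0.
have cE : eta / 2 - Lh * M2 - c1 = c1 by rewrite /c1; lra.
rewrite cE -/F0 in Wdec.
(* By comparison with [t *: W], the linearised objective closes the fraction [t]
   of the gap to the optimal value. *)
pose P := f (X k) + inner (G (X k)) (V k) + h (X k + V k) - F0.
have HP : P <= (1 - t) * (u k - F0).
  have h1 : 2^-1 * (kap2 * fnorm W ^+ 2) <= Kq * x.
    rewrite [leRHS](_ : _ = 2^-1 * (kap2 * ((1 + M2) ^+ 2 * x))).
      by rewrite ler_pM2l ?invr_gt0 //; apply: ler_wpM2l kap2_ge0 _ _ wx.
    by rewrite /Kq; ring.
  have h2 : t ^+ 2 * (2^-1 * (kap2 * fnorm W ^+ 2)) <= t * (c1 * x).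
    apply: (@le_trans _ _ (t ^+ 2 * (Kq * x))); first by apply: ler_wpM2l h1; exact: sqr_ge0.
    rewrite expr2 -mulrA ler_pM2l // mulrA ler_wpM2r //; lra.
  have h3 : t * (f (X k) + inner (G (X k)) W + h (X k + W)) <= t * (F0 - c1 * x).
    by rewrite ler_pM2l.
  by rewrite /P /u; lra.
have h4 : a * P <= a * ((1 - t) * (u k - F0)) by rewrite ler_pM2l.
have h5 : (1 - a * t) * (u k - F0) <= (1 - amin * t) * b.
  have h6 : a * t <= 1 by rewrite mulr_ile1 ?(ltW a0) ?(ltW t0).
  apply: (@le_trans _ _ ((1 - a * t) * b)); first by rewrite ler_wpM2l // subr_ge0.
  by rewrite ler_wpM2r // lerD2l lerN2 ler_pM2r.
have a2 : a ^+ 2 <= 1 by rewrite exprn_ile1 // ltW.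
have h7 : C * a ^+ 2 * v <= (C + 1) * v.
  rewrite ler_wpM2r //; apply: (@le_trans _ _ C); last by lra.
  by rewrite ler_piMr.
have h8 : u k.+1 - F0 <= (1 - amin * t) * b + (C + 1) * v.
  by move: tp h4; rewrite /P; lra.
have h9 : u k.+1 - F0 <= b - c * v by rewrite /b; lra.
rewrite -(ler_pM2l D0).
have -> : (C + 1 + c) * (q * (u (l k) - F0)) = (C + 1 + c) * b - c * (amin * t) * b.
  by rewrite /q -/b; field; rewrite gt_eqF.
have h10 : c * (u k.+1 - F0) <= c * ((1 - amin * t) * b + (C + 1) * v).
  by rewrite ler_pM2l.
have h11 : (C + 1) * (u k.+1 - F0) <= (C + 1) * (b - c * v).
  by rewrite ler_wpM2l //; lra.
lra.
Qed.

End Convergence.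

(** * The convergence theorem *)

Lemma grad_bound_ge0 {R : realType} {n r : nat} (f : 'M[R]_(n, r) -> R) :
  0 <= grad_bound f.
Proof.
rewrite /grad_bound; set A := [set _ | _ in _].
have [hA|/sup_out -> //] := pselect (has_sup A).
have [[x Ax] _] := hA; apply: le_trans (sup_upper_bound hA Ax).
by have [X _ <-] := Ax; exact: fnorm_ge0.
Qed.

Lemma kappa1_gt0 {R : realType} (L rho delta : R) (p : nat) :
  0 <= L -> 0 <= rho -> 0 < delta -> 0 < kappa1 L rho delta p.
Proof.
move=> L0 rho0 d0; rewrite /kappa1 invr_gt0.
have u5 : 5 <= upsilon L rho delta.
  by rewrite /upsilon ler_pdivlMr //; lra.
move: (upsilon L rho delta) u5 => u u5.
have u2 : 0 < u ^+ 2 - 1 by rewrite expr2; nra.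
apply: ltr_wpDl; last by rewrite divr_gt0 // exprn_gt0 //; lra.
apply: mulr_ge0; last by rewrite divr_ge0 // ltW.
apply: divr_ge0; last exact: ltW.
by rewrite subr_ge0 exprn_ege1 //; lra.
Qed.

Lemma kappa2_ge0 {R : realType} (L rho delta : R) (p : nat) :
  0 < delta -> 0 <= kappa2 L rho delta p.
Proof.
move=> d0; rewrite /kappa2 addr_ge0 ?(ltW d0) // mulr_ge0 //.
by rewrite divr_ge0 ?(ltW d0) // mulr_ge0 ?sqr_ge0.
Qed.

Lemma cluster_fnorm {R : realType} {n r : nat} (X : nat -> 'M[R]_(n, r)) X0
  (eps : R) (K : nat) : cluster (X @ \oo) X0 -> 0 < eps ->
  exists2 k, (K <= k)%N & fnorm (X k - X0) <= eps.
Proof.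
move=> Xcl e0.
have A : (X @ \oo) [set X k | k in [set k | (K <= k)%N]].
  by exists K => // k /= Kk; exists k.
have B : nbhs X0 [set Y | fnorm (Y - X0) <= eps].
  by apply/nbhs_fnormP; exists eps.
by have [_ [[k Kk <-] kX]] := Xcl _ _ A B; exists k.
Qed.

Theorem theorem4p3 (R : realType) (n r : nat)
  (f h : 'M[R]_(n, r) -> R) (L Lh : R)
  (Rt : 'M[R]_(n, r) -> 'M[R]_(n, r) -> 'M[R]_(n, r)) (M1 M2 : R)
  (delta : R) (p : nat) (gamma sigma : R) (m : nat)
  (B : nat -> 'M[R]_(n, r) -> 'M[R]_(n, r))
  (X V : nat -> 'M[R]_(n, r)) (N l : nat -> nat)
  (Xstar : 'M[R]_(n, r)) (eta : R)
  (f_C2 : Ck_on 2 [set: 'M[R]_(n, r)] (f : 'M[R]_(n, r) -> R^o))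
  (f_lip : frob_lipschitz_mx L (grad f))
  (h_convex : convex_function [set: convex_lmodType 'M[R]_(n, r)] h)
  (h_lip : frob_lipschitz Lh h)
  (Rt_retraction : retraction Rt)
  (M1_gt0 : 0 < M1) (M2_gt0 : 0 < M2)
  (M1_bound : forall Y xi, stiefel Y -> tangent Y xi ->
     fnorm (Rt Y xi - Y) <= M1 * fnorm xi)
  (M2_bound : forall Y xi, stiefel Y -> tangent Y xi ->
     fnorm (Rt Y xi - Y - xi) <= M2 * fnorm xi ^+ 2)
  (delta_gt0 : 0 < delta) (p_gt0 : (0 < p)%N)
  (gamma_01 : 0 < gamma < 1) (sigma_01 : 0 < sigma < 1) (m_gt0 : (0 < m)%N)
  (run : ManPQN f h Rt gamma sigma m B X V N)
  (l_argmax : forall k, window_argmax m (fun j => (f \+ h) (X j)) k (l k))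
  (B_bounds : forall k W, tangent (X k) W ->
     kappa1 L (grad_bound f) delta p * fnorm W ^+ 2 <= sqnormB (B k) W /\
     sqnormB (B k) W <= kappa2 L (grad_bound f) delta p * fnorm W ^+ 2)
  (Xstar_acc : cluster (X @ \oo) Xstar)
  (eta_gt : 5 * Lh * M2 < eta)
  (hess_lb : (eta%:E <= lambda_min (tangent Xstar)
     (hess_on (tangent Xstar) (fun xi => f (Rt Xstar xi)) 0))%E) :
  exists (K : nat) (mu tau : R),
    [/\ 0 < mu, 0 < tau, tau < 1
      & forall k, (K < k)%N ->
          (f \+ h) (X k) - (f \+ h) Xstar <=
          mu * tau ^+ (k - K) * ((f \+ h) (X (l K)) - (f \+ h) Xstar)].
Proof.
have [start run'] := run.
have [Rst _ _ _] := Rt_retraction.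
(* The constants are nonnegative unless the matrix space is trivial. *)
have [[A A0]|trivial] := pselect (exists A : 'M[R]_(n, r), A != 0); last first.
  have all_eq (Y Z : 'M[R]_(n, r)) : Y = Z.
    apply/eqP; rewrite -subr_eq0; apply/negPn/negP => YZ.
    by apply: trivial; exists (Y - Z).
  exists 0%N, 1, 2^-1; split; [by []|by rewrite invr_gt0|lra|] => k _.
  by rewrite (all_eq (X k) Xstar) (all_eq (X _) Xstar) !subrr mulr0.
have A1 : 0 < fnorm (A - 0) by rewrite subr0 fnorm_gt0.
have L0 : 0 <= L.
  by rewrite -(pmulr_lge0 _ A1) (le_trans _ (f_lip A 0)) // fnorm_ge0.
have Lh0 : 0 <= Lh by rewrite -(pmulr_lge0 _ A1) (le_trans _ (h_lip A 0)).
have fd Y : differentiable (f : 'M[R]_(n, r) -> R^o) Y.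
  by have [+ _] := f_C2; exact.
have fG Y : differentiable (f : 'M[R]_(n, r) -> R^o) Y /\
    forall W, 'D_W (f : 'M[R]_(n, r) -> R^o) Y = inner (grad f Y) W.
  by split=> // W; exact: derive_grad.
have dataf := twice_diff_data (C2_twice_diff Xstar f_C2).
have V_min k W : tangent (X k) W ->
    inner (grad f (X k)) (V k) + 2^-1 * sqnormB (B k) (V k) + h (X k + V k)
    <= inner (grad f (X k)) W + 2^-1 * sqnormB (B k) W + h (X k + W).
  by have [_ [_ Vmin] _ _ _] := run' k; exact: Vmin.
have pullback (sX : stiefel Xstar) := pullback_lower_bound f_C2 Rt_retraction sX hess_lb.
have k1 := kappa1_gt0 p L0 (grad_bound_ge0 f) delta_gt0.
have k2 := kappa2_ge0 L (grad_bound f) p delta_gt0.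
move: B_bounds k1 k2; set kap1 := kappa1 _ _ _ _; set kap2 := kappa2 _ _ _ _.
move=> B_bounds k1 k2; clearbody kap1 kap2.
move: f_lip fG dataf V_min pullback.
move: (grad f) (hessian _ _) => G H f_lip fG dataf V_min pullback.
apply: (@linear_convergence _ _ _ f h G H L Lh Rt M1 M2 eta Xstar L0 fG f_lip dataf h_convex Lh0 h_lip M1_gt0 M2_gt0
  Rst M1_bound M2_bound eta_gt pullback gamma sigma kap1 kap2 m B X V N l
  gamma_01 sigma_01 k1 k2 start _ V_min _ _ l_argmax).
- by move=> k; have [_ [TV _] _ _ _] := run' k.
- by move=> k; have [_ _ _ _] := run' k.
- by move=> k W /B_bounds [lo hi]; rewrite lo hi.
- move=> k; have [_ _ ok _ Xk] := run' k.
  rewrite Xk; apply: (le_trans ok); apply: lerB => //.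
  exact: window_max_le (l_argmax k).
- move=> k j jN; have [_ _ _ bad _] := run' k.
  rewrite ltNge; apply/negP => le_ok; apply: (bad j jN).
  rewrite /line_search_ok; apply: (le_trans le_ok); apply: lerB => //.
  exact: (window_max_ge m (fun j => (f \+ h) (X j)) k).
- by move=> eps K; exact: cluster_fnorm.
Qed.
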